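(* Let $\overline{M}$ be a smooth manifold of dimension $n+1$ with boundary $\partial M$ and interior $M$, and let $g$ be a projectively compact Ricci-flat pseudo-Riemannian metric on $M$. Let $\rho:U\to\mathbb{R}_{\ge0}$ be a local defining function for $\partial M$, with $\rho_a:=d\rho$, such that the boundary value of $\rho^{-3}g^{ij}\rho_j$ vanishes identically and the function $\nu:=\rho^{-4}g^{ab}\rho_a\rho_b$ is of the form $\nu=\nu_0+\rho^2\nu_2$ for a non-zero constant $\nu_0$ and a smooth function $\nu_2$ on $U$. Then (shrinking $U$ around $U\cap\partial M$ so that $\nu$ is nowhere vanishing on $U$) the tensor field $$h=\rho^2g-\frac1\nu\frac{d\rho\odot d\rho}{\rho^2}$$ extends smoothly to the boundary, the restriction of its boundary value to $T(U\cap\partial M)$ is non-degenerate, and for any vector field $\zeta\in\mathfrak{X}(U)$ with $d\rho(\zeta)=0$ the function $\rho^{-2}\,\zeta\cdot\nu^{-1}$ is smooth up to the boundary.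
   Context: All affine connections are torsion free; smooth means $C^\infty$; $g^{ij}$ is the inverse metric. For a one-form $\Upsilon$, $\nabla+\Upsilon$ denotes the connection $(\xi,\eta)\mapsto\nabla_\xi\eta+\Upsilon(\xi)\eta+\Upsilon(\eta)\xi$. A local defining function for $\partial M$ is a smooth $\rho:U\to\mathbb{R}_{\ge0}$, $U\subset\overline{M}$ open, with $\rho^{-1}(\{0\})=U\cap\partial M$ and $d\rho\neq0$ along $U\cap\partial M$. A pseudo-Riemannian metric $g$ on $M$ with Levi-Civita connection $\nabla$ is projectively compact of order $\alpha>0$ if near each boundary point there is a defining function $\rho$ such that $\nabla+\frac{d\rho}{\alpha\rho}$ extends smoothly to the boundary; it is projectively compact if this holds for some $\alpha>0$ (for Ricci-flat $g$ the order is then necessarily one). For such $g$ and any local defining function $\rho$, the fields $\rho^{-2}g^{ij}$, $\rho^{-3}g^{ij}\rho_j$ and $\rho^{-4}g^{ij}\rho_i\rho_j$ on $U\cap M$ extend smoothly to $U$; ''boundary value'' refers to these extensions. $d\rho\odot d\rho$ is the tensor $(\xi,\eta)\mapsto d\rho(\xi)d\rho(\eta)$. *)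

(* Defs.v *)
From HB Require Import structures.
From mathcomp Require Import all_boot all_order all_algebra.
From mathcomp Require Import all_classical all_reals all_analysis.
Set Implicit Arguments.
Unset Strict Implicit.
Unset Printing Implicit Defensive.
Import Order.TTheory GRing.Theory Num.Theory.
Import numFieldNormedType.Exports.
Local Open Scope classical_set_scope.
Local Open Scope ring_scope.

(* Calculus on the closed half space {x_0 >= 0} of R^(n+1).  Points are row   *)
(* vectors.  Difference quotients only use points of the half space, so that *)
(* hpartial is the usual partial derivative at points with x_0 > 0, and at   *)
(* points with x_0 = 0 it is the one-sided derivative in the direction       *)
(* normal to the boundary (and the usual one in the other directions).       *)

Section HalfSpace.
Context {R : realType} {n : nat}.
Implicit Types (i : 'I_n.+1) (f : 'rV[R]_n.+1 -> R) (x : 'rV[R]_n.+1).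

Definition half_space : set 'rV[R]_n.+1 := [set x | 0 <= x 0 0].

Definition hquotients i f x : set_system R :=
  (fun t : R => t^-1 * (f (x + t *: delta_mx 0 i) - f x)) @
    within [set t | half_space (x + t *: delta_mx 0 i)] 0^'.

Definition hpartial i f x : R := lim (hquotients i f x).

(* C^k on a relatively open subset D of the half space: the iterated partial *)
(* derivatives up to order k exist and are continuous up to the boundary.    *)
Fixpoint hCk (k : nat) (D : set 'rV[R]_n.+1) f : Prop :=
  {within D, continuous f} /\
  (if k is k'.+1 then
     forall i, (forall x, D x -> cvg (hquotients i f x)) /\
               hCk k' D (hpartial i f)
   else True).

Definition hsmooth (D : set 'rV[R]_n.+1) f : Prop := forall k, hCk k D f.

End HalfSpace.

Record bchart (R : realType) (n : nat) (T : topologicalType) := BChart {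
  cdom : set T;
  cmap : T -> 'rV[R]_n.+1;
  cinv : 'rV[R]_n.+1 -> T;
  cdom_open : open cdom;
  cmap_image : exists2 O : set 'rV[R]_n.+1,
    open O & cmap @` cdom = O `&` half_space;
  cmapK : forall p, cdom p -> cinv (cmap p) = p;
  cmap_continuous : {within cdom, continuous cmap};
  cinv_continuous : {within cmap @` cdom, continuous cinv} }.

Section ChartCalculus.
Context {R : realType} {n : nat} {T : topologicalType}.
Implicit Types (c : bchart R n T) (U : set T) (f : T -> R).

Definition smooth_in_chart c U f : Prop :=
  hsmooth (cmap c @` (cdom c `&` U)) (f \o cinv c).

(* the derivative of f along the i-th coordinate vector field of c *)
Definition dchart c (i : 'I_n.+1) f (p : T) : R :=
  hpartial i (f \o cinv c) (cmap c p).

End ChartCalculus.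

(* A smooth manifold with boundary of dimension n+1, given by a smooth       *)
(* (not necessarily maximal) atlas.                                          *)
Record bmanifold (R : realType) (n : nat) := BManifold {
  pt :> topologicalType;
  pt_hausdorff : hausdorff_space pt;
  pt_second_countable : @second_countable pt;
  idx : Type;
  chart : idx -> bchart R n pt;
  chart_cover : forall p : pt, exists c, cdom (chart c) p;
  chart_compatible : forall (c d : idx) (j : 'I_n.+1),
    smooth_in_chart (chart c) (cdom (chart d))
      (fun p => cmap (chart d) p 0 j) }.

Section Manifold.
Context {R : realType} {n : nat} (M : bmanifold R n).
Implicit Types (c d : idx M) (U : set M) (p : M) (i j k l m : 'I_n.+1).

Definition dom c : set M := cdom (chart c).

Definition coord c j p : R := cmap (chart c) p 0 j.

Definition mboundary : set M := [set p | exists2 c, dom c p & coord c 0 p = 0].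

Definition minterior : set M := ~` mboundary.

Definition pd c i (f : M -> R) : M -> R := dchart (chart c) i f.

Definition smooth_at_chart c U (f : M -> R) : Prop :=
  smooth_in_chart (chart c) U f.

Definition smooth_on U (f : M -> R) : Prop := forall c, smooth_at_chart c U f.

Definition jac c d p : 'M[R]_n.+1 := \matrix_(i, j) pd c i (coord d j) p.

(* Tensor fields and connections are given by their components in all the    *)
(* charts of the atlas.  Vectors and covectors are rows; the value of a      *)
(* component outside the domain of its chart is irrelevant.                  *)

Definition vfield := idx M -> M -> 'rV[R]_n.+1.

Definition tensor2 := idx M -> M -> 'M[R]_n.+1.

(* G c p k i j is the symbol with upper index k and lower indices i, j       *)
Definition symbols := idx M -> M -> 'I_n.+1 -> 'M[R]_n.+1.

Definition agree_on (E : Type) U (s t : idx M -> M -> E) : Prop :=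
  forall c p, dom c p -> U p -> s c p = t c p.

Definition vector_field U (v : vfield) : Prop :=
  (forall c j, smooth_at_chart c U (fun p => v c p 0 j)) /\
  (forall c d p, dom c p -> dom d p -> U p -> v d p = v c p *m jac c d p).

Definition covariant2_field U (h : tensor2) : Prop :=
  (forall c i j, smooth_at_chart c U (fun p => h c p i j)) /\
  (forall c d p, dom c p -> dom d p -> U p ->
     h c p = jac c d p *m h d p *m (jac c d p)^T).

Definition pseudo_riemannian_metric (g : tensor2) : Prop :=
  [/\ covariant2_field minterior g,
      forall c p, dom c p -> minterior p -> (g c p)^T = g c p &
      forall c p, dom c p -> minterior p -> g c p \in unitmx].

(* smooth torsion free affine connections on U *)
Definition affine_connection U (G : symbols) : Prop :=
  [/\ forall c k i j, smooth_at_chart c U (fun p => G c p k i j),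
      forall c d p, dom c p -> dom d p -> U p -> forall i j m,
        \sum_k G c p k i j * jac c d p k m =
        pd c i (pd c j (coord d m)) p +
        \sum_a \sum_b G d p m a b * jac c d p i a * jac c d p j b &
      forall c p, dom c p -> U p -> forall k i j, G c p k i j = G c p k j i].

Definition levi_civita (g : tensor2) (G : symbols) : Prop :=
  affine_connection minterior G /\
  forall c p, dom c p -> minterior p -> forall k i j,
    pd c k (fun q => g c q i j) p =
    \sum_l (G c p l k i * g c p l j + G c p l k j * g c p i l).

(* R(d_i, d_j) d_l = \sum_k (curvature G c p i j l k) d_k *)
Definition curvature (G : symbols) c p i j l k : R :=
  pd c i (fun q => G c q k j l) p - pd c j (fun q => G c q k i l) p +
  \sum_m (G c p k i m * G c p m j l - G c p k j m * G c p m i l).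

Definition ricci (G : symbols) c p j l : R := \sum_k curvature G c p k j l k.

Definition ricci_flat (G : symbols) : Prop :=
  forall c p, dom c p -> minterior p -> forall j l, ricci G c p j l = 0.

Definition differential (f : M -> R) : vfield :=
  fun c p => \row_i pd c i f p.

Definition directional (z : vfield) (f : M -> R) c p : R :=
  \sum_i z c p 0 i * pd c i f p.

Definition projective_change (G : symbols) (Y : vfield) : symbols :=
  fun c p k => \matrix_(i, j)
    (G c p k i j + Y c p 0 i * (k == j)%:R + Y c p 0 j * (k == i)%:R).

Definition defining_function U (rho : M -> R) : Prop :=
  [/\ open U,
      smooth_on U rho,
      forall p, U p -> 0 <= rho p,
      forall p, U p -> (rho p = 0 <-> mboundary p) &
      forall c p, dom c p -> U p -> mboundary p -> differential rho c p != 0].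

(* to be used with G the Levi-Civita connection of the metric *)
Definition projectively_compact_of_order (alpha : R) (G : symbols) : Prop :=
  forall p, mboundary p -> exists U (rho : M -> R),
    [/\ U p, defining_function U rho &
        exists2 Gbar : symbols, affine_connection U Gbar &
          agree_on (U `&` minterior) Gbar
            (projective_change G
               (fun c q => (alpha * rho q)^-1 *: differential rho c q))].

Definition projectively_compact (G : symbols) : Prop :=
  exists2 alpha : R, 0 < alpha & projectively_compact_of_order alpha G.

(* g^{ij} rho_j *)
Definition gradient (g : tensor2) (rho : M -> R) : vfield :=
  fun c p => differential rho c p *m invmx (g c p).

(* g^{ab} rho_a rho_b *)
Definition gradient_norm2 (g : tensor2) (rho : M -> R) c p : R :=
  (differential rho c p *m invmx (g c p) *m (differential rho c p)^T) 0 0.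

Definition h_tensor (g : tensor2) (rho nu : M -> R) : tensor2 :=
  fun c p => rho p ^+ 2 *: g c p -
    ((nu p)^-1 / rho p ^+ 2) *:
      ((differential rho c p)^T *m differential rho c p).

(* In a chart around a boundary point, the vectors tangent to the boundary   *)
(* are those whose component 0 vanishes.                                     *)
Definition boundary_tangent (v : 'rV[R]_n.+1) : Prop := v 0 0 = 0.

Definition nondegenerate_on_boundary U (h : tensor2) : Prop :=
  forall c p, dom c p -> U p -> mboundary p ->
  forall v : 'rV[R]_n.+1, boundary_tangent v ->
    (forall w : 'rV[R]_n.+1, boundary_tangent w ->
       (v *m h c p *m w^T) 0 0 = 0) ->
    v = 0.

(* V is obtained by shrinking U around the boundary points of U, and the     *)
(* function nu has no zero on V                                              *)
Definition shrinking U (nu : M -> R) (V : set M) : Prop :=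
  [/\ open V, V `<=` U, U `&` mboundary `<=` V & forall p, V p -> nu p != 0].

End Manifold.

(* Main.v *)
(* Write [r] for the covector [d rho].  Near a boundary point, dividing two defining functions
   shows that the Levi-Civita symbols are [Gam_k = Gh_k - beta / rho * (r_k 1 + e_k r)] with [Gh]
   smooth up to the boundary and [beta = 1 / alpha].  Differentiating [rho^4 nu = g^-1(r, r)] gives
   [2 (d_k r - r Gh_k) X^T = 4 (1 - beta) r_k nu + rho d_k nu] for [X = rho^-3 g^-1 r]; as [X] and
   [rho] vanish on the boundary, the order is one.  Now [X = rho Y] with [Y] smooth, and
   [K = rho^-2 g^-1 + ((1 - rho^2) / nu) Y^T Y] satisfies [r K = Y] and, on the interior, a linear
   system [d_k K = B_k K + K B_k^T] with [B] smooth up to the boundary; the inverse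
   [L = K^-1 = h + r^T r / nu] solves the dual system.  By Gronwall, solutions of such systems
   extend smoothly to the boundary, so [K] and [L] do, and they remain inverse to each other.
   A vector [v] in the kernel of the restriction of [h] to the boundary has [v L] proportional to
   [r = Y L], so it is a multiple of [Y], which is transverse to the boundary since [r(Y) = nu].
   Finally, [zeta . nu = rho^2 (zeta . nu2)] when [d rho (zeta) = 0]. *)
Require Import Defs.
From HB Require Import structures.
From mathcomp Require Import all_boot all_order all_algebra.
From mathcomp Require Import all_classical all_reals all_analysis.
From mathcomp Require Import ring lra.
Set Implicit Arguments.
Unset Strict Implicit.
Unset Printing Implicit Defensive.
Import Order.TTheory GRing.Theory Num.Theory.
Import numFieldNormedType.Exports.
Local Open Scope classical_set_scope.
Local Open Scope ring_scope.

(** * Calculus on the closed half space *)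

(** The boundary value of [rho^-2 g^-1] annihilates [r], because [r (rho^-2 g^-1) = rho^2 Y]. So it
    cannot be inverted at the boundary, and its derivative contains the inhomogeneous term
    [rho (e_k Y + Y^T e_k^T)]. Since [r(Y) = nu], the coefficient [f = (1 - rho^2) / nu] is the one
    with [rho^2 + f nu = 1], that is, with [r K = Y]. This identity removes both obstacles: each [Y]
    in the derivative can be written [r K], which makes the system homogeneous, and the inverse
    becomes explicit, the degenerate direction of [h] being filled by [r^T r / nu]. As the inverse
    solves a system of the same kind, non-degeneracy at the boundary needs no lower bound on a
    determinant: [K L = 1] is an identity that passes to the limit. The other obstacle is the
    boundary itself. Derivatives there are one-sided, and [mboundary] asks only for one chart that
    sees the point on the edge of the half space. Identities are therefore proved where [x_0 > 0]
    and carried over by continuity, and the defining function is what makes all charts agree on the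
    boundary points of its domain. *)

Section HalfSpaceCalculus.
Context {R : realType} {n : nat}.
Local Notation E := 'rV[R]_n.+1.
Local Notation H := (@half_space R n).
Implicit Types (i j k : 'I_n.+1) (x y : E) (f : E -> R) (D : set E).

Definition box x (r : R) y := forall j, `|y 0 j - x 0 j| < r.

Definition hnbhs x : set_system E := within H (nbhs x).

Definition hcont (T : topologicalType) (f : E -> T) x := f @ hnbhs x --> f x.

Definition hopen D := forall x, D x -> H x /\ hnbhs x D.

(** As a relation this carries the existence of the limit, which the value [hpartial], a bare [lim],
    does not. *)
Definition hder i f x (l : R) := hquotients i f x --> l.

Definition hint D := D `&` [set x | 0 < x 0 0].

Lemma moveE x (t : R) i j : (x + t *: delta_mx 0 i) 0 j = x 0 j + t * (j == i)%:R.
Proof. by rewrite !mxE eqxx /=. Qed.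

Lemma hnbhsP x (P : set E) :
  hnbhs x P <-> exists2 r : R, 0 < r & forall y, H y -> box x r y -> P y.
Proof.
rewrite /hnbhs /within /= -nbhs_ballE /nbhs_ball; split.
  case=> r r0 rP; exists r => // y Hy bxy; apply: rP => //; split => // i j.
  by rewrite (ord1 i) /ball /= distrC; exact: bxy.
case=> r r0 rP; exists r => // y [_ bxy] Hy; apply: rP => // j.
by have := bxy 0 j; rewrite /ball /= distrC.
Qed.

Lemma hnbhs_self x D : hopen D -> D x -> H x. Proof. by move=> oD /oD[]. Qed.

#[global] Instance hnbhs_filter x : Filter (hnbhs x).
Proof. exact: within_filter. Qed.

Lemma hcontP f x : hcont f x <-> forall e : R, 0 < e ->
  exists2 r : R, 0 < r & forall y, H y -> box x r y -> `|f y - f x| < e.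
Proof.
split=> [/cvgrPdist_lt fx e e0|fx].
  by have /hnbhsP[r r0 rP] := fx e e0; exists r => // y Hy bxy; rewrite distrC; exact: rP.
apply/cvgrPdist_lt => e e0; apply/hnbhsP.
by have [r r0 rP] := fx e e0; exists r => // y Hy bxy; rewrite distrC; exact: rP.
Qed.

(** Multiplying the quotient by [t] makes the estimate meaningful at [t = 0] as well, so that no
    punctured neighbourhood remains and errors can be added. *)
Lemma hderP i f x l : hder i f x l <-> forall e : R, 0 < e ->
  exists2 r : R, 0 < r & forall t : R, `|t| < r -> H (x + t *: delta_mx 0 i) ->
  `|f (x + t *: delta_mx 0 i) - f x - t * l| <= e * `|t|.
Proof.
have aux t : t != 0 -> `|f (x + t *: delta_mx 0 i) - f x - t * l| =
     `|l - t^-1 * (f (x + t *: delta_mx 0 i) - f x)| * `|t|.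
  by move=> t0; rewrite -normrM -normrN; congr (`| _ |); field.
split=> [/cvgrPdist_le hl e e0|hl].
  have := hl e e0; rewrite ?near_simpl => /=.
  rewrite /nbhs/= /within/= /dnbhs /within/= -nbhs_ballE => -[r /= r0 rP].
  exists r => // t tr Ht; have [->|t0] := eqVneq t 0.
    by rewrite scale0r addr0 subrr mul0r subrr normr0 mulr0.
  rewrite aux// ler_pM2r ?normr_gt0//.
  by apply: rP => //; rewrite /ball /= sub0r normrN.
apply/cvgrPdist_le => e e0; rewrite ?near_simpl /=.
rewrite /nbhs/= /within/= /dnbhs /within/= -nbhs_ballE.
have [r r0 rP] := hl e e0; exists r => //= t; rewrite /ball /= sub0r normrN => tr t0 Ht.
by have := rP t tr Ht; rewrite aux// ler_pM2r ?normr_gt0//.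
Qed.

Lemma half_space_move x t i : H x -> 0 <= t -> H (x + t *: delta_mx 0 i).
Proof. by rewrite /half_space /= moveE => x0 t0; rewrite addr_ge0// mulr_ge0// ler0n. Qed.

(** A positive [t] never leaves the half space, so the filter is non-trivial even at a boundary
    point in the normal direction. This is what makes one-sided limits unique. *)
Lemma hline_proper i x : H x ->
  ProperFilter (within [set t : R | H (x + t *: delta_mx 0 i)] 0^').
Proof.
move=> Hx; apply: Build_ProperFilter_ex => P.
rewrite /within/= /dnbhs /within/= -nbhs_ballE => -[r /= r0 rP].
exists (r / 2); apply: rP => //=.
- rewrite /ball /= sub0r normrN gtr0_norm ?divr_gt0//; lra.
- by rewrite mulf_neq0// ?gt_eqF// ?invr_gt0// ltr0n.
- apply: half_space_move => //; rewrite divr_ge0// ltW//.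
Qed.

Lemma hderE i f x l : H x -> hder i f x l -> hpartial i f x = l.
Proof.
move=> Hx fl; have PF := hline_proper i Hx.
by apply: cvg_lim fl; exact: (@norm_hausdorff _ R^o).
Qed.

Lemma hder_hpartial i f x : cvg (hquotients i f x) -> hder i f x (hpartial i f x).
Proof. by []. Qed.

Lemma hopen_box D x : hopen D -> D x ->
  exists2 r : R, 0 < r & forall y, H y -> box x r y -> D y.
Proof. by move=> oD /oD[_ /hnbhsP]. Qed.

Lemma hopenI D D' : hopen D -> hopen D' -> hopen (D `&` D').
Proof.
move=> oD oD' x [Dx D'x]; split; first by have [] := oD _ Dx.
by apply: filterI; [have [] := oD _ Dx|have [] := oD' _ D'x].
Qed.

Lemma hopen_boxI x r : hopen (box x r `&` H).
Proof.
move=> y [bxy Hy]; split => //; apply/hnbhsP.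
have [d d0 dP] : exists2 d, 0 < d & forall j, `|y 0 j - x 0 j| + d <= r.
  have [j _ /= jmax] := @arg_maxP _ _ _ (ord0 : 'I_n.+1) xpredT (fun j => `|y 0 j - x 0 j|) isT.
  exists (r - `|y 0 j - x 0 j|); first by rewrite subr_gt0.
  by move=> i; have := jmax i isT; lra.
exists d => // z Hz byz; split => // j.
have -> : z 0 j - x 0 j = (z 0 j - y 0 j) + (y 0 j - x 0 j) by ring.
by apply: le_lt_trans (ler_normD _ _) _; have := byz j; have := dP j; lra.
Qed.

Lemma boxxx x r : 0 < r -> box x r x.
Proof. by move=> r0 j; rewrite subrr normr0. Qed.

Lemma hopen_int D : hopen D -> hopen (hint D).
Proof.
move=> oD x [Dx /= x0]; split; first exact: ltW.
apply: filterI; first by have [] := oD _ Dx.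
by apply/hnbhsP; exists (x 0 0) => // y _ /(_ 0); rewrite ltr_norml /=; lra.
Qed.

(** A partial derivative gives continuity only along its own coordinate line, which is all that the
    product and quotient rules use. *)
Lemma hder_cont_line i f x l : hder i f x l ->
  f (x + t *: delta_mx 0 i) @[t --> within [set t | H (x + t *: delta_mx 0 i)] 0^'] --> f x.
Proof.
move=> /hderP hl; apply/cvgrPdist_lt => e e0.
have [r r0 rP] := hl 1 ltr01.
have a0 : 0 < 1 + `|l| by rewrite ltr_pwDl.
rewrite ?near_simpl /nbhs/= /within/= /dnbhs /within/= -nbhs_ballE.
exists (Num.min r (e / (1 + `|l|))); first by rewrite /= lt_min r0 divr_gt0.
move=> t; rewrite /ball /= sub0r normrN lt_min => /andP[tr te] t0 Ht.
rewrite distrC; apply: le_lt_trans (_ : (1 + `|l|) * `|t| < _).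
  rewrite mulrDl -(normrM l).
  have -> : f (x + t *: delta_mx 0 i) - f x =
      (f (x + t *: delta_mx 0 i) - f x - t * l) + l * t by ring.
  by apply: le_trans (ler_normD _ _) _; rewrite lerD2r; exact: rP.
by rewrite mulrC -ltr_pdivlMr.
Qed.

Lemma hder_cst i (c : R) x : hder i (fun=> c) x 0.
Proof.
by apply/hderP => e e0; exists 1 => // t _ _; rewrite subrr mulr0 subrr normr0 mulr_ge0// ltW.
Qed.

Lemma hder_coord i j x : hder i (fun y => y 0 j) x (j == i)%:R.
Proof.
apply/hderP => e e0; exists 1 => // t _ _; rewrite moveE.
by rewrite [x 0 j + _]addrC addrK subrr normr0 mulr_ge0// ltW.
Qed.

Lemma near_hder i f x l (q : R -> R) :
  q @ within [set t | H (x + t *: delta_mx 0 i)] 0^' --> l ->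
  (\forall t \near within [set t | H (x + t *: delta_mx 0 i)] 0^',
     t^-1 * (f (x + t *: delta_mx 0 i) - f x) = q t) ->
  hder i f x l.
Proof.
move=> ql e; apply: cvg_trans ql; rewrite /hquotients.
apply: near_eq_cvg; first by apply: filterS e => t ->.
Qed.

Lemma hderD i f g x a b : hder i f x a -> hder i g x b ->
  hder i (fun y => f y + g y) x (a + b).
Proof.
move=> fa gb; apply: near_hder (cvgD fa gb) _.
by apply: nearW => t /=; rewrite !fctE; ring.
Qed.

Lemma hderM i f g x a b : hder i f x a -> hder i g x b ->
  hder i (fun y => f y * g y) x (a * g x + f x * b).
Proof.
move=> fa gb; have gc := hder_cont_line gb.
apply: near_hder (cvgD (cvgM fa gc) (cvgM (cvg_cst (f x)) gb)) _.
by apply: nearW => t /=; rewrite !fctE /GRing.mul_fun; ring.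
Qed.

Lemma hderV i f x a : f x != 0 -> hder i f x a ->
  hder i (fun y => (f y)^-1) x (- a / f x ^+ 2).
Proof.
move=> fx0 fa; have fc := hder_cont_line fa.
rewrite expr2 invfM.
apply: near_hder (cvgM (cvgN fa) (cvgM (cvg_cst (f x)^-1) (cvgV fx0 fc))) _.
have : \forall t \near within [set t | H (x + t *: delta_mx 0 i)] 0^',
    f (x + t *: delta_mx 0 i) != 0 by exact: (cvgr_neq0 _ fc fx0).
apply: filterS => t ft0.
rewrite /GRing.mul_fun /= -[(- _) t]/(- (t^-1 * _)) -mulrN -mulrA; congr (_ * _).
by field; rewrite fx0 ft0.
Qed.

End HalfSpaceCalculus.

(** * Functions smooth up to the boundary *)

Section SmoothFunctions.
Context {R : realType} {n : nat}.
Local Notation E := 'rV[R]_n.+1.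
Local Notation H := (@half_space R n).
Implicit Types (i j : 'I_n.+1) (x y : E) (f g : E -> R) (D : set E) (k : nat).

Lemma box_move x r t i : `|t| < r -> box x r (x + t *: delta_mx 0 i).
Proof.
move=> tr j; rewrite moveE addrAC subrr add0r normrM.
by case: eqP => _; rewrite ?normr1 ?normr0 ?mulr1 ?mulr0//; exact: le_lt_trans tr.
Qed.

Lemma boxW x r r' y : r <= r' -> box x r y -> box x r' y.
Proof. by move=> rr' b j; exact: lt_le_trans (b j) rr'. Qed.

Lemma hder_congr D i f g x l : hopen D -> D x -> (forall y, D y -> f y = g y) ->
  hder i f x l -> hder i g x l.
Proof.
move=> oD Dx fg /hderP fl; apply/hderP => e e0.
have [r r0 rP] := fl e e0; have [r' r'0 r'P] := hopen_box oD Dx.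
exists (Num.min r r'); first by rewrite lt_min r0.
move=> t; rewrite lt_min => /andP[tr tr'] Ht.
by rewrite -!fg//; [exact: rP|apply: r'P => //; exact: box_move].
Qed.

Lemma hcont_congr D f g x : hopen D -> D x -> (forall y, D y -> f y = g y) ->
  hcont f x -> hcont g x.
Proof.
move=> oD Dx fg /hcontP fc; apply/hcontP => e e0.
have [r r0 rP] := fc e e0; have [r' r'0 r'P] := hopen_box oD Dx.
exists (Num.min r r'); first by rewrite lt_min r0.
move=> y Hy bxy; rewrite -!fg//.
  by apply: rP => //; apply: boxW bxy; rewrite ge_min lexx.
by apply: r'P => //; apply: boxW bxy; rewrite ge_min lexx orbT.
Qed.

Lemma hnbhs_within D x : hopen D -> D x -> within D (nbhs x) = hnbhs x.
Proof.
move=> oD Dx; have [_] := oD _ Dx; rewrite /hnbhs /within /= => nD.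
apply/seteqP; split=> P /=; first by apply: filterS2 nD => y HD DP /HD /DP.
by apply: filterS => y HP /(hnbhs_self oD) /HP.
Qed.

Lemma hcont_withinP D f : hopen D ->
  {within D, continuous f} <-> (forall x, D x -> hcont f x).
Proof.
move=> oD; rewrite subspace_continuousP; split=> fc x Dx; have := fc x Dx;
  by rewrite hnbhs_within.
Qed.

Lemma norm_bool_le1 (b : bool) : `|b%:R : R| <= 1.
Proof. by rewrite normr_nat lern1 leq_b1. Qed.

Lemma hCk0P D f : hopen D -> hCk 0 D f <-> (forall x, D x -> hcont f x).
Proof. by move=> oD; split=> [[/(hcont_withinP _ oD)]//|c]; split=> //; exact/hcont_withinP. Qed.

Lemma hCk_cont k D f : hopen D -> hCk k D f -> forall x, D x -> hcont f x.
Proof. by move=> oD; case: k => [|k] [/(hcont_withinP _ oD)]. Qed.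

Lemma hCk_congr k D f g : hopen D -> (forall x, D x -> f x = g x) ->
  hCk k D f -> hCk k D g.
Proof.
move=> oD; elim: k f g => [|k IH] f g fg.
  rewrite !hCk0P// => fc x Dx; exact: (hcont_congr oD Dx fg (fc x Dx)).
move=> [/(hcont_withinP _ oD) fc fk]; split.
  by apply/(hcont_withinP _ oD) => x Dx; exact: (hcont_congr oD Dx fg (fc x Dx)).
move=> i; have [cf kf] := fk i.
have gl x : D x -> hder i g x (hpartial i f x).
  by move=> Dx; apply: (hder_congr oD Dx fg); exact: hder_hpartial (cf x Dx).
split; first by move=> x Dx; apply/cvg_ex; exists (hpartial i f x); exact: gl.
by apply: IH kf => x Dx; rewrite (hderE _ (gl x Dx))//; exact: hnbhs_self Dx.
Qed.

(** Any function that is pointwise the derivative may serve as witness, so smoothness can be proved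
    from a formula for the derivative without computing [hpartial]. *)
Lemma hCkSP k D f : hopen D -> hCk k.+1 D f <->
  (forall x, D x -> hcont f x) /\
  (forall i, exists2 F : E -> R, (forall x, D x -> hder i f x (F x)) & hCk k D F).
Proof.
move=> oD; split=> [[/(hcont_withinP _ oD) fc fk]|[fc fk]].
  by split=> // i; have [cf kf] := fk i; exists (hpartial i f).
split; first by apply/(hcont_withinP _ oD).
move=> i; have [F hF kF] := fk i; split.
  by move=> x Dx; apply/cvg_ex; exists (F x); exact: hF.
by apply: hCk_congr kF => // x Dx; rewrite (hderE _ (hF x Dx))//; exact: hnbhs_self Dx.
Qed.

Lemma hCk_sub k D D' f : D' `<=` D -> hCk k D f -> hCk k D' f.
Proof.
move=> sD; elim: k f => [|k IH] f [fc fk].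
  by split => //; exact: continuous_subspaceW fc.
split; first exact: continuous_subspaceW fc.
by move=> i; have [dc dk] := fk i; split; [move=> y /sD; exact: dc|exact: IH].
Qed.

Lemma hCk_loc k D f : hopen D ->
  (forall x, D x -> exists D', [/\ hopen D', D' x & hCk k D' f]) -> hCk k D f.
Proof.
move=> oD; elim: k f => [|k IH] f fl.
  by apply/hCk0P => // x /fl[D' [oD' D'x /(hCk_cont oD')]]; exact.
apply/hCkSP => //; split=> [x /fl[D' [oD' D'x /(hCk_cont oD')]]|i]; first exact.
exists (hpartial i f).
  move=> x Dx; have [D' [oD' D'x /(hCkSP _ _ oD')[_ /(_ i)[F hF _]]]] := fl x Dx.
  by rewrite (hderE _ (hF x D'x)); [exact: hF|exact: hnbhs_self Dx].
apply: IH => x Dx; have [D' [oD' D'x /(hCkSP _ _ oD')[_ /(_ i)[F hF kF]]]] := fl x Dx.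
exists D'; split => //; apply: hCk_congr kF => // y D'y.
by rewrite (hderE _ (hF y D'y))//; exact: hnbhs_self D'y.
Qed.

Lemma hCkW k D f : hopen D -> hCk k.+1 D f -> hCk k D f.
Proof.
move=> oD; elim: k f => [|k IH] f.
  by rewrite hCkSP// hCk0P// => -[].
rewrite (hCkSP k.+1)// => -[fc fk]; apply/hCkSP => //; split=> // i.
by have [F hF kF] := fk i; exists F => //; exact: IH.
Qed.

Lemma hCk_cst k D (c : R) : hopen D -> hCk k D (fun=> c).
Proof.
move=> oD; elim: k c => [|k IH] c.
  by apply/hCk0P => // x _; exact: cvg_cst.
apply/hCkSP => //; split=> [x _|i]; first exact: cvg_cst.
by exists (fun=> 0) => // x _; exact: hder_cst.
Qed.

Lemma hcont_coord j x : hcont (fun y : E => y 0 j) x.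
Proof. by apply/hcontP => e e0; exists e => // y _; exact. Qed.

Lemma hCk_coord k D j : hopen D -> hCk k D (fun y => y 0 j).
Proof.
move=> oD; case: k => [|k].
  by apply/hCk0P => // x _; exact: hcont_coord.
apply/hCkSP => //; split=> [x _|i]; first exact: hcont_coord.
by exists (fun=> (j == i)%:R); [move=> x _; exact: hder_coord|exact: hCk_cst].
Qed.

Lemma hcontD f g x : hcont f x -> hcont g x -> hcont (fun y => f y + g y) x.
Proof. by move=> fc gc; exact: cvgD. Qed.

Lemma hcontM f g x : hcont f x -> hcont g x -> hcont (fun y => f y * g y) x.
Proof. by move=> fc gc; exact: cvgM. Qed.

Lemma hcontV f x : f x != 0 -> hcont f x -> hcont (fun y => (f y)^-1) x.
Proof. by move=> f0 fc; exact: cvgV. Qed.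

Lemma hCkD k D f g : hopen D -> hCk k D f -> hCk k D g -> hCk k D (fun y => f y + g y).
Proof.
move=> oD; elim: k f g => [|k IH] f g.
  by rewrite !hCk0P// => fc gc x Dx; apply: hcontD; [exact: fc|exact: gc].
rewrite !hCkSP// => -[fc fk] [gc gk]; split=> [x Dx|i].
  by apply: hcontD; [exact: fc|exact: gc].
have [F hF kF] := fk i; have [G hG kG] := gk i.
by exists (fun y => F y + G y); [move=> x Dx; apply: hderD; auto|exact: IH].
Qed.

Lemma hCkM k D f g : hopen D -> hCk k D f -> hCk k D g -> hCk k D (fun y => f y * g y).
Proof.
move=> oD; elim: k f g => [|k IH] f g.
  by rewrite !hCk0P// => fc gc x Dx; apply: hcontM; [exact: fc|exact: gc].
(* The derivative of the product contains [f] and [g] undifferentiated, so their regularity of the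
   lower order is kept at hand for the induction. *)
move=> kf kg; have := hCkW oD kf; have := hCkW oD kg; move: kf kg.
rewrite !(hCkSP k)// => -[fc fk] [gc gk] kg kf; split=> [x Dx|i].
  by apply: hcontM; [exact: fc|exact: gc].
have [F hF kF] := fk i; have [G hG kG] := gk i.
exists (fun y => F y * g y + f y * G y); first by move=> x Dx; apply: hderM; auto.
by apply: hCkD => //; exact: IH.
Qed.

Lemma hCkV k D f : hopen D -> (forall x, D x -> f x != 0) -> hCk k D f ->
  hCk k D (fun y => (f y)^-1).
Proof.
move=> oD f0; elim: k => [|k IH].
  by rewrite !hCk0P// => fc x Dx; apply: hcontV; [exact: f0|exact: fc].
move=> kf; have := hCkW oD kf; move: kf.
rewrite !(hCkSP k)// => -[fc fk] /IH kV; split=> [x Dx|i].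
  by apply: hcontV; [exact: f0|exact: fc].
have [F hF kF] := fk i.
exists (fun y => (-1 * F y) * ((f y)^-1 * (f y)^-1)).
  move=> x Dx; rewrite -invfM -expr2 mulN1r; apply: hderV; first exact: f0.
  exact: hF.
by apply: hCkM => //; apply: hCkM => //; exact: hCk_cst.
Qed.

Lemma hCk_sum k D (I : Type) (s : seq I) (P : pred I) (F : I -> E -> R) : hopen D ->
  (forall a, hCk k D (F a)) -> hCk k D (fun y => \sum_(a <- s | P a) F a y).
Proof.
move=> oD kF; elim: s => [|a s IH].
  by apply: (hCk_congr (f := fun=> 0)) => // [x _|]; [rewrite big_nil|exact: hCk_cst].
apply: (hCk_congr (f := fun y => (if P a then F a y else 0) + \sum_(a <- s | P a) F a y)) => //.
  by move=> x _; rewrite big_cons; case: (P a) => //; rewrite add0r.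
by apply: hCkD => //; case: (P a) => //; exact: hCk_cst.
Qed.

Section Smooth.
Variables (D : set E) (oD : hopen D).

Lemma hs_cont f : hsmooth D f -> forall x, D x -> hcont f x.
Proof. by move=> sf; exact: (hCk_cont oD (sf 0)). Qed.

Lemma hs_congr f g : (forall x, D x -> f x = g x) -> hsmooth D f -> hsmooth D g.
Proof. by move=> fg sf k; apply: hCk_congr (sf k). Qed.

Lemma hs_sub D' f : D' `<=` D -> hsmooth D f -> hsmooth D' f.
Proof. by move=> sD sf k; exact: hCk_sub (sf k). Qed.

Lemma hs_loc f :
  (forall x, D x -> exists D', [/\ hopen D', D' x & hsmooth D' f]) -> hsmooth D f.
Proof.
move=> fl k; apply: hCk_loc => // x /fl[D' [oD' D'x sf]].
by exists D'; split => //; exact: sf.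
Qed.

Lemma hs_cst (c : R) : hsmooth D (fun=> c).
Proof. by move=> k; exact: hCk_cst. Qed.

Lemma hs_coord j : hsmooth D (fun y => y 0 j).
Proof. by move=> k; exact: hCk_coord. Qed.

Lemma hsD f g : hsmooth D f -> hsmooth D g -> hsmooth D (fun y => f y + g y).
Proof. by move=> sf sg k; exact: hCkD. Qed.

Lemma hsM f g : hsmooth D f -> hsmooth D g -> hsmooth D (fun y => f y * g y).
Proof. by move=> sf sg k; exact: hCkM. Qed.

Lemma hsN f : hsmooth D f -> hsmooth D (fun y => - f y).
Proof.
move=> sf; apply: (@hs_congr (fun y => -1 * f y)) => [x _|]; first by rewrite mulN1r.
by apply: hsM => //; exact: hs_cst.
Qed.

Lemma hsB f g : hsmooth D f -> hsmooth D g -> hsmooth D (fun y => f y - g y).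
Proof. by move=> sf sg; apply: hsD => //; exact: hsN. Qed.

Lemma hsV f : (forall x, D x -> f x != 0) -> hsmooth D f -> hsmooth D (fun y => (f y)^-1).
Proof. by move=> f0 sf k; exact: hCkV. Qed.

Lemma hs_sum (I : Type) (s : seq I) (P : pred I) (F : I -> E -> R) :
  (forall a, hsmooth D (F a)) -> hsmooth D (fun y => \sum_(a <- s | P a) F a y).
Proof. by move=> sF k; apply: hCk_sum => // a; exact: sF. Qed.

Lemma hsX f m : hsmooth D f -> hsmooth D (fun y => f y ^+ m).
Proof.
move=> sf; elim: m => [|m IH]; first exact: hs_cst.
by apply: (@hs_congr (fun y => f y * f y ^+ m)) => [x _|]; [rewrite exprS|exact: hsM].
Qed.

Lemma hs_hder i f : hsmooth D f -> forall x, D x -> hder i f x (hpartial i f x).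
Proof. by move=> sf x Dx; have [_ /(_ i)[fc _]] := sf 1; exact: hder_hpartial (fc x Dx). Qed.

Lemma hs_partial i f : hsmooth D f -> hsmooth D (hpartial i f).
Proof. by move=> sf k; have [_ /(_ i)[_]] := sf k.+1. Qed.

End Smooth.

(** * Mean value estimates, derivatives at the boundary, symmetry of second derivatives *)

Lemma hder_line i f x (s t l : R) : 0 < (x + (s * t) *: delta_mx 0 i) 0 0 ->
  hder i f (x + (s * t) *: delta_mx 0 i) l ->
  is_derive s 1 (fun u : R => f (x + (u * t) *: delta_mx 0 i)) (t * l).
Proof.
set y := x + _ => y0 /hderP fl.
have : (fun h : R => h^-1 *: (f (x + ((h *: 1 + s) * t) *: delta_mx 0 i) - f y)) @ 0^'
    --> t * l.
  apply/cvgrPdist_le => e e0.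
  have t1 : 0 < 1 + `|t| by rewrite ltr_pwDl.
  have [r r0 rP] := fl (e / (1 + `|t|)) (divr_gt0 e0 t1).
  rewrite ?near_simpl /nbhs/= /dnbhs /within/= -nbhs_ballE.
  exists (Num.min r (y 0 0) / (1 + `|t|)); first by rewrite /= divr_gt0// lt_min r0.
  move=> h; rewrite /ball /= sub0r normrN ltr_pdivlMr// => hr h0.
  (* The bound by [y 0 0] keeps the shifted point inside the half space, where the one-sided
     constraint is void. *)
  have hts : `|h * t| < Num.min r (y 0 0).
    by apply: le_lt_trans hr; rewrite normrM ler_wpM2l// lerDr.
  have -> : x + ((h *: 1 + s) * t) *: delta_mx 0 i = y + (h * t) *: delta_mx 0 i.
    by rewrite /y -addrA -scalerDl -[h *: 1]/(h * 1); congr (_ + _ *: _); ring.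
  move: hts; rewrite lt_min => /andP[h1 h2].
  have Hy : H (y + (h * t) *: delta_mx 0 i).
    have := box_move y i h2 => /(_ 0); rewrite /half_space /= ltr_norml; lra.
  have := rP _ h1 Hy; rewrite -[h^-1 *: _]/(h^-1 * _).
  set d := f _ - f y => dP.
  have -> : t * l - h^-1 * d = - (h^-1 * (d - h * t * l)) by field.
  rewrite normrN normrM normfV ler_pdivrMl ?normr_gt0//.
  apply: le_trans dP _; rewrite normrM.
  have -> : e / (1 + `|t|) * (`|h| * `|t|) = `|h| * (e * (`|t| / (1 + `|t|))) by ring.
  rewrite ler_wpM2l// ler_piMr//; first exact: ltW.
  by rewrite ler_pdivrMr// mul1r lerDr.
move=> fl'; have cf : cvg ((fun h : R => h^-1 *: (f (x + ((h *: 1 + s) * t) *: delta_mx 0 i)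
   - f y)) @ 0^') by apply/cvg_ex; exists (t * l).
by split => //; exact: (cvg_lim (@norm_hausdorff _ R^o) fl').
Qed.

Lemma hMVT i f (F : E -> R) x t :
  (forall s, 0 <= s <= 1 -> 0 < (x + (s * t) *: delta_mx 0 i) 0 0 /\
     hder i f (x + (s * t) *: delta_mx 0 i) (F (x + (s * t) *: delta_mx 0 i))) ->
  exists2 s, 0 <= s <= 1 &
    f (x + t *: delta_mx 0 i) - f x = t * F (x + (s * t) *: delta_mx 0 i).
Proof.
move=> fF.
have dF (s : R) : s \in `[0, 1]%R -> is_derive s 1 (fun u : R => f (x + (u * t) *: delta_mx 0 i))
    (t * F (x + (s * t) *: delta_mx 0 i)).
  by rewrite in_itv /= => s01; have [? ?] := fF s s01; exact: hder_line.
have [|s s01] := MVT_segment (@ler01 R) (fun s s01 => dF s (subset_itv_oo_cc s01)).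
  by apply: derivable_within_continuous => s /dF [].
rewrite mul1r mul0r scale0r addr0 subr0 mulr1 => ->.
by exists s.
Qed.

Lemma hMVT_le i f x t m (e : R) :
  (forall s, 0 <= s <= 1 -> 0 < (x + (s * t) *: delta_mx 0 i) 0 0 /\
     exists2 l, hder i f (x + (s * t) *: delta_mx 0 i) l & `|l - m| <= e) ->
  `|f (x + t *: delta_mx 0 i) - f x - t * m| <= e * `|t|.
Proof.
move=> fF; have [|s s01 ->] := @hMVT i f (hpartial i f) x t.
  move=> s /fF [p [l hl _]]; split => //; rewrite (hderE _ hl)//.
  exact: ltW p.
have [p [l hl lm]] := fF s s01; rewrite (hderE _ hl); last exact: ltW p.
by rewrite -mulrBr normrM mulrC ler_wpM2r.
Qed.

Lemma segment_pos x t i s : 0 < x 0 0 -> 0 < (x + t *: delta_mx 0 i) 0 0 -> 0 <= s <= 1 ->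
  0 < (x + (s * t) *: delta_mx 0 i) 0 0.
Proof.
rewrite !moveE => x0 y0 /andP[s0 s1].
have -> : x 0 0 + s * t * (0 == i)%:R =
  (1 - s) * x 0 0 + s * (x 0 0 + t * (0 == i)%:R) by ring.
have [->|s00] := eqVneq s 0; first by rewrite subr0 mul1r mul0r addr0.
apply: ltr_wpDl; first by rewrite mulr_ge0// ?subr_ge0// ltW.
by rewrite mulr_gt0// lt0r s00.
Qed.

Lemma segment_box z r x t i s : box z r x -> box z r (x + t *: delta_mx 0 i) -> 0 <= s <= 1 ->
  box z r (x + (s * t) *: delta_mx 0 i).
Proof.
move=> bx bt /andP[s0 s1] j; have := bx j; have := bt j; rewrite !moveE.
set a := x 0 j - z 0 j; set b := x 0 j + t * _ - z 0 j => br ar.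
have -> : x 0 j + s * t * (j == i)%:R - z 0 j = (1 - s) * a + s * b.
  by rewrite /a /b; ring.
apply: le_lt_trans (ler_normD _ _) _; rewrite !normrM (ger0_norm s0) ger0_norm ?subr_ge0//.
have [->|s00] := eqVneq s 0; first by rewrite subr0 mul1r mul0r addr0.
have -> : r = (1 - s) * r + s * r by ring.
apply: ler_ltD; first by rewrite ler_wpM2l ?subr_ge0// ltW.
by rewrite ltr_pM2l// lt0r s00.
Qed.

(* The points are joined by a path moving one coordinate at a time. *)
Lemma hpath_le z r f (m : 'I_n.+1 -> R) e :
  (forall y, box z r y -> 0 < y 0 0 -> forall i, exists2 l, hder i f y l & `|l - m i| <= e) ->
  forall x y, box z r x -> 0 < x 0 0 -> box z r y -> 0 < y 0 0 ->
  `|f y - f x - \sum_i m i * (y 0 i - x 0 i)| <= e * \sum_i `|y 0 i - x 0 i|.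
Proof.
move=> fm x y bx x0 by_ y0.
pose p k : E := \row_j (if (j < k)%N then y 0 j else x 0 j).
have pS (i : 'I_n.+1) : p i.+1 = p i + (y 0 i - x 0 i) *: delta_mx 0 i.
  apply/rowP => j; rewrite moveE !mxE ltnS leq_eqVlt.
  have [->|ji] := eqVneq j i; first by rewrite eqxx ltnn /= mulr1 addrC subrK.
  by rewrite (negbTE (_ : (j : nat) != i))// mulr0 addr0.
have p0 : p 0 = x by apply/rowP => j; rewrite mxE.
have pn : p n.+1 = y by apply/rowP => j; rewrite mxE ltn_ord.
have bp k : box z r (p k) by move=> j; rewrite mxE; case: ifP.
have pp k : 0 < p k 0 0 by rewrite mxE; case: ifP.
have -> : f y - f x = \sum_(i < n.+1) (f (p i.+1) - f (p i)).
  by rewrite -(big_mkord xpredT (fun i : nat => f (p i.+1) - f (p i))) telescope_sumr// pn p0.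
rewrite -sumrB mulr_sumr; apply: le_trans (ler_norm_sum _ _ _) _.
apply: ler_sum => i _; rewrite pS [m i * _]mulrC.
apply: hMVT_le => s s01; split.
  by apply: segment_pos; rewrite -?pS.
by apply: fm; [apply: segment_box; rewrite -?pS|apply: segment_pos; rewrite -?pS].
Qed.

(* At a boundary point, shift inwards, use the mean value theorem in the interior and let
   the shift tend to 0. *)
Lemma hder_ext D i f (F : E -> R) x : hopen D -> (forall y, D y -> hcont f y) -> D x ->
  hcont F x -> (forall y, hint D y -> hder i f y (F y)) -> hder i f x (F x).
Proof.
move=> oD fc Dx /hcontP Fc fF; apply/hderP => e e0.
have [r1 r10 r1P] := Fc e e0; have [r2 r20 r2P] := hopen_box oD Dx.
set r := Num.min r1 r2; have r0 : 0 < r by rewrite lt_min r10.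
exists r => // t tr Ht; set xt := x + _.
have Hx := hnbhs_self oD Dx.
have Dxt : D xt.
  by apply: r2P => //; apply: boxW (box_move x i tr); rewrite ge_min lexx orbT.
apply/ler_addgt0Pl => d d0.
have d20 : 0 < d / 2 by rewrite divr_gt0.
have [r3 r30 r3P] := (hcontP _ _).1 (fc _ Dx) (d / 2) d20.
have [r4 r40 r4P] := (hcontP _ _).1 (fc _ Dxt) (d / 2) d20.
set s := Num.min (r - `|t|) (Num.min r3 r4) / 2.
have m0 : 0 < Num.min (r - `|t|) (Num.min r3 r4) by rewrite !lt_min subr_gt0 tr r30.
have s0 : 0 < s by rewrite divr_gt0.
have [sr [s3 s4]] : s < r - `|t| /\ s < r3 /\ s < r4.
  have : s < Num.min (r - `|t|) (Num.min r3 r4) by rewrite /s; lra.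
  by rewrite !lt_min => /and3P[].
pose xs := x + s *: delta_mx 0 0.
have xsE : xs + t *: delta_mx 0 i = xt + s *: delta_mx 0 0 by rewrite /xs /xt addrAC.
have a1 : `|f xs - f x| < d / 2.
  apply: r3P; first by apply: half_space_move => //; exact: ltW.
  by apply: box_move; rewrite gtr0_norm.
have a2 : `|f (xs + t *: delta_mx 0 i) - f xt| < d / 2.
  rewrite xsE; apply: r4P; first by apply: half_space_move => //; exact: ltW.
  by apply: box_move; rewrite gtr0_norm.
have a3 : `|f (xs + t *: delta_mx 0 i) - f xs - t * F x| <= e * `|t|.
  apply: hMVT_le => u u01.
  have up : 0 < (xs + (u * t) *: delta_mx 0 i) 0 0.
    have xs0 : 0 < xs 0 0 by rewrite moveE eqxx mulr1 ltr_wpDl.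
    apply: segment_pos => //; rewrite xsE moveE eqxx mulr1 ltr_wpDl//.
  have ub : box x r (xs + (u * t) *: delta_mx 0 i).
    move=> j; rewrite !moveE.
    have -> : x 0 j + s * (j == 0)%:R + u * t * (j == i)%:R - x 0 j =
       s * (j == 0)%:R + u * t * (j == i)%:R by ring.
    apply: le_lt_trans (ler_normD _ _) _.
    have -> : r = (r - `|t|) + `|t| by ring.
    case/andP: u01 => u0 u1; apply: ltr_leD.
      apply: le_lt_trans sr; rewrite normrM (gtr0_norm s0).
      by apply: ler_piMr; [exact: ltW|exact: norm_bool_le1].
    rewrite !normrM (ger0_norm u0) -mulrA mulrCA; apply: ler_piMr => //.
    by apply: mulr_ile1 => //; exact: norm_bool_le1.
  have Hu : H (xs + (u * t) *: delta_mx 0 i) by exact: ltW up.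
  split => //; exists (F (xs + (u * t) *: delta_mx 0 i)).
    apply: fF; split => //; apply: r2P => //; apply: boxW ub.
    by rewrite ge_min lexx orbT.
  by apply/ltW/r1P => //; apply: boxW ub; rewrite ge_min lexx.
have -> : f xt - f x - t * F x = (f (xs + t *: delta_mx 0 i) - f xs - t * F x) +
   (f xs - f x - (f (xs + t *: delta_mx 0 i) - f xt)) by ring.
apply: le_trans (ler_normD _ _) _; rewrite addrC lerD//.
by apply: le_trans (ler_normB _ _) _; lra.
Qed.

Lemma hder_shift i f y v l : 0 < (y + v) 0 0 -> hder i f (y + v) l ->
  hder i (fun z => f (z + v)) y l.
Proof.
move=> p /hderP fl; apply/hderP => e e0; have [r r0 rP] := fl e e0.
exists (Num.min r ((y + v) 0 0)); first by rewrite lt_min r0.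
move=> t; rewrite lt_min => /andP[tr tp] _; rewrite (addrAC y); apply: rP => //.
have := box_move (y + v) i tp => /(_ 0); rewrite /half_space /= ltr_norml; lra.
Qed.

(** Schwarz's theorem: two mean value arguments estimate the second difference of [f] with steps [h]
    and [t] by [h * t * c]. For [t] small the differences in direction [j] become [t] times
    [hpartial j f]. *)
Lemma hder_swap D i j f x : hopen D -> hsmooth D f -> hint D x ->
  hder i (hpartial j f) x (hpartial j (hpartial i f) x).
Proof.
move=> oD sf Dx; have oI := hopen_int oD.
have sfi := hs_partial i sf; have sfij := hs_partial j sfi.
set c := hpartial j (hpartial i f) x.
apply/hderP => e e0.
have [r1 r10 r1P] := (hcontP _ _).1 (hs_cont oD sfij Dx.1) e e0.
have [r2 r20 r2P] := hopen_box oI Dx.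
have x0 : 0 < x 0 0 by case: Dx.
set r := Num.min (x 0 0) (Num.min r1 r2).
have rle : [/\ r <= x 0 0, r <= r1 & r <= r2] by rewrite /r !ge_min !lexx !orbT.
have r0 : 0 < r by rewrite !lt_min x0 r10.
have bI y : box x r y -> hint D y.
  case: rle => ra rb rc b; apply: r2P; last exact: boxW b.
  by have := b 0; rewrite /half_space /= ltr_norml; lra.
have bc y : box x r y -> `|hpartial j (hpartial i f) y - c| <= e.
  case: rle => ra rb rc b; apply/ltW/r1P; last exact: boxW b.
  by have := b 0; rewrite /half_space /= ltr_norml; lra.
clearbody r; exists (r / 2); first by rewrite divr_gt0.
move=> h hr _; apply/ler_addgt0Pl => d d0.
have d20 : 0 < d / 2 by rewrite divr_gt0.
have hb2 : box x (r / 2) (x + h *: delta_mx 0 i) by exact: box_move.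
have hb : box x r (x + h *: delta_mx 0 i) by apply: boxW hb2; lra.
have [r3 r30 r3P] := (hderP _ _ _ _).1 (hs_hder (i:=j) sf (bI _ hb).1) (d / 2) d20.
have [r4 r40 r4P] := (hderP _ _ _ _).1 (hs_hder (i:=j) sf Dx.1) (d / 2) d20.
set m := Num.min r (Num.min r3 r4); have m0 : 0 < m by rewrite lt_min r0 lt_min r30.
(* [t] is chosen after [h] and [d], small enough for the two differences in direction [j] to be
   linear up to [d / 2 * t] each. Dividing by [t] leaves the error [d], which is arbitrary. *)
set t := m / 2; have t0 : 0 < t by rewrite divr_gt0.
have mle : [/\ m <= r, m <= r3 & m <= r4] by rewrite /m !ge_min !lexx !orbT.
have near_t (y : E) : box x (r / 2) y -> box x r (y + t *: delta_mx 0 j).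
  move=> b l; rewrite moveE.
  have -> : y 0 l + t * (l == j)%:R - x 0 l = (y 0 l - x 0 l) + t * (l == j)%:R by ring.
  apply: le_lt_trans (ler_normD _ _) _.
  have : `|t * (l == j)%:R| <= r / 2.
    rewrite normrM (gtr0_norm t0); apply: le_trans (_ : t <= _).
      by apply: ler_piMr; [exact: ltW|exact: norm_bool_le1].
    by case: mle => ? _ _; rewrite /t; lra.
  by have := b l; lra.
have HbI y : box x r y -> H y by move=> /bI [_]; exact: ltW.
have xb : box x (r / 2) x by apply: boxxx; rewrite divr_gt0.
have tn : `|t| = t by rewrite gtr0_norm.
have [tm3 tm4] : t < r3 /\ t < r4 by case: mle; rewrite /t; lra.
have a1 := r3P t; rewrite tn in a1; have {}a1 := a1 tm3 (HbI _ (near_t _ hb2)).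
have a2 := r4P t; rewrite tn in a2; have {}a2 := a2 tm4 (HbI _ (near_t _ xb)).
pose g y := f (y + t *: delta_mx 0 j) - f y.
have a3 : `|g (x + h *: delta_mx 0 i) - g x - h * (t * c)| <= (e * t) * `|h|.
  apply: hMVT_le => s s01.
  have sb : box x (r / 2) (x + (s * h) *: delta_mx 0 i) by exact: segment_box.
  set y := x + (s * h) *: _ in sb *.
  have yb : box x r y by apply: boxW sb; lra.
  have ytb := near_t _ sb.
  split; first by have [] := bI _ yb.
  exists (hpartial i f (y + t *: delta_mx 0 j) + - hpartial i f y).
    apply: hderD.
      by apply: hder_shift; [have [] := bI _ ytb|apply: (hs_hder (i:=i) sf (bI _ ytb).1)].
    have := hderM (hder_cst i (-1) y) (hs_hder (i:=i) sf (bI _ yb).1).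
    rewrite mul0r add0r mulN1r; apply: (hder_congr oD (bI _ yb).1) => z _.
    by rewrite mulN1r.
  rewrite -[in e * t]tn; apply: hMVT_le => u u01.
  have ub : box x r (y + (u * t) *: delta_mx 0 j) by exact: segment_box.
  split; first by have [] := bI _ ub.
  by exists (hpartial j (hpartial i f) (y + (u * t) *: delta_mx 0 j));
    [exact: (hs_hder (i:=j) sfi (bI _ ub).1)|exact: bc].
rewrite -(ler_pM2l t0) -[X in X * _ <= _]tn -normrM.
have -> : t * (hpartial j f (x + h *: delta_mx 0 i) - hpartial j f x - h * c) =
  (g (x + h *: delta_mx 0 i) - g x - h * (t * c)) +
  ((f (x + t *: delta_mx 0 j) - f x - t * hpartial j f x) -
  (f (x + h *: delta_mx 0 i + t *: delta_mx 0 j) - f (x + h *: delta_mx 0 i) -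
     t * hpartial j f (x + h *: delta_mx 0 i))) by rewrite /g; ring.
apply: le_trans (ler_normD _ _) _.
have -> : t * (d + e * `|h|) = (e * t) * `|h| + (d / 2 * t + d / 2 * t) by field.
by apply: lerD => //; apply: le_trans (ler_normB _ _) _; exact: lerD.
Qed.

End SmoothFunctions.

(** * Division by the boundary coordinate *)

Section Hadamard.
Context {R : realType} {n : nat}.
Local Notation E := 'rV[R]_n.+1.
Local Notation H := (@half_space R n).
Implicit Types (i j : 'I_n.+1) (x y : E) (f g : E -> R) (D : set E) (k : nat).

(** At [m = 0] the truncated exponent [m.-1] is harmless, since its coefficient [m%:R] is zero. *)
Lemma hder_coordX i m x :
  hder i (fun y => y 0 0 ^+ m) x (m%:R * x 0 0 ^+ m.-1 * (0 == i)%:R).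
Proof.
elim: m => [|m IH]; first by rewrite mul0r mul0r; exact: hder_cst.
have := hderM (hder_coord (i:=i) (j:=0) x) IH.
have -> : (0 == i)%:R * x 0 0 ^+ m + x 0 0 * (m%:R * x 0 0 ^+ m.-1 * (0 == i)%:R) =
   m.+1%:R * x 0 0 ^+ m.+1.-1 * (0 == i)%:R.
  case: m {IH} => [|m] /=; first by rewrite !expr0; ring.
  by rewrite !exprS -!natr1; ring.
have -> // : (fun y : E => y 0 0 ^+ m.+1) = (fun y => y 0 0 * y 0 0 ^+ m).
by apply/funext => y; rewrite exprS.
Qed.

Lemma hcont_line i f x t :
  (forall s : R, 0 <= s <= 1 -> H (x + (s * t) *: delta_mx 0 i) /\
    hcont f (x + (s * t) *: delta_mx 0 i)) ->
  {within `[0, 1], continuous (fun s : R => f (x + (s * t) *: delta_mx 0 i))}.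
Proof.
move=> fc; apply/subspace_continuousP => s; rewrite /= in_itv /= => s01.
have [Hs /hcontP cs] := fc s s01; apply/cvgrPdist_lt => e e0.
have [r r0 rP] := cs e e0; have t1 : 0 < 1 + `|t| by rewrite ltr_pwDl.
rewrite near_withinE; apply/nbhs_ballP.
exists (r / (1 + `|t|)); first by rewrite /= divr_gt0.
move=> u; rewrite /ball /= => su; rewrite in_itv /= => u01.
rewrite distrC; apply: rP; first by have [] := fc u u01.
have -> : x + (u * t) *: delta_mx 0 i =
  x + (s * t) *: delta_mx 0 i + ((u - s) * t) *: delta_mx 0 i.
  by rewrite -addrA -scalerDl; congr (_ + _ *: _); ring.
apply: box_move; move: su; rewrite ltr_pdivlMr// normrM distrC => su.
by apply: le_lt_trans su; rewrite ler_wpM2l// lerDr.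
Qed.

(* For [N] vanishing on the boundary with [d_0 N = x_0 ^ m * h], this is
   [\int_0^1 t ^ m * h (t * x_0, x') dt]. *)
Definition haverage m (N h : E -> R) x : R :=
  if x 0 0 == 0 then h x / m.+1%:R else N x / x 0 0 ^+ m.+1.

Definition haverage_spec D m (N h : E -> R) :=
  [/\ hsmooth D N, hsmooth D h, forall x, D x -> x 0 0 = 0 -> N x = 0 &
     forall x, hint D x -> hpartial 0 N x = x 0 0 ^+ m * h x].

(** The mean value form of the integral. Rolle's theorem is applied to [phi], which vanishes at both
    ends of the normal segment from the boundary to [y]; the factor [m.+1] is the one in the
    derivative of [s ^+ m.+1]. *)
Lemma haverage_MVT D m N h y : hopen D -> haverage_spec D m N h -> 0 < y 0 0 ->
  (forall s : R, 0 <= s <= 1 -> D (y + ((s - 1) * y 0 0) *: delta_mx 0 0)) ->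
  exists2 s : R, 0 <= s <= 1 &
    N y / y 0 0 ^+ m.+1 = h (y + ((s - 1) * y 0 0) *: delta_mx 0 0) / m.+1%:R.
Proof.
move=> oD [sN sh N0 dN] y0 Dy; set b := y - y 0 0 *: delta_mx 0 0.
have bE s : y + ((s - 1) * y 0 0) *: delta_mx 0 0 = b + (s * y 0 0) *: delta_mx 0 0.
  by rewrite /b -addrA -scaleNr -scalerDl; congr (_ + _ *: _); ring.
have b0 s : (b + (s * y 0 0) *: delta_mx 0 0) 0 0 = s * y 0 0.
  by rewrite -bE moveE eqxx mulr1; ring.
have Db s : 0 <= s <= 1 -> D (b + (s * y 0 0) *: delta_mx 0 0) by move=> /Dy; rewrite bE.
pose phi (s : R) := N (b + (s * y 0 0) *: delta_mx 0 0) - N y * s ^+ m.+1.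
pose dphi (s : R) := y 0 0 * hpartial 0 N (b + (s * y 0 0) *: delta_mx 0 0) -
  N y * (m.+1%:R * s ^+ m).
have [||c c01] := @MVT R phi dphi 0 1 ltr01.
- move=> s; rewrite in_itv /= => /andP[s0 s1].
  have s01 : 0 <= s <= 1 by rewrite !ltW.
  have d1 : is_derive s 1 (fun u : R => N (b + (u * y 0 0) *: delta_mx 0 0))
     (y 0 0 * hpartial 0 N (b + (s * y 0 0) *: delta_mx 0 0)).
    by apply: hder_line; [rewrite b0 mulr_gt0|exact: hs_hder (Db _ s01)].
  have d2 : is_derive s 1 (fun u : R => N y * u ^+ m.+1) (N y * (m.+1%:R * s ^+ m)).
    have d2 := @is_deriveZ _ _ _ _ (N y) _ _ _ (@is_deriveX _ _ _ m.+1 _ _ _ (is_derive_id s (1 : R))).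
    have -> : (fun u : R => N y * u ^+ m.+1) = N y \*: (id ^+ m.+1).
      by apply/funext => u; rewrite /= exprfctE.
    by apply: is_derive_eq d2 _; rewrite /GRing.scale /= mulr1.
  exact: is_deriveB.
- have c1 := @hcont_line 0 N b (y 0 0).
  have c2 : {within `[0, 1], continuous (fun u : R => u ^+ m.+1)}.
    by apply: continuous_subspaceT => u; exact: exprn_continuous.
  move=> s; apply: cvgB.
    apply: c1 => u u01; have Du := Db u u01.
    by split; [exact: hnbhs_self Du|exact: (hs_cont oD sN Du)].
  apply: cvgM; first exact: cvg_cst.
  exact: c2.
have bdry : N b = 0.
  have := Db 0; rewrite mul0r scale0r addr0 lexx ler01 => /(_ isT) Db0.
  by apply: N0 => //; have := b0 0; rewrite mul0r scale0r addr0.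
have bK : b + (1 * y 0 0) *: delta_mx 0 0 = y by rewrite mul1r subrK.
rewrite /phi /dphi bK mul0r scale0r addr0 bdry expr1n expr0n /= mulr1 mulr0 !subrr subr0 mulr1.
move: c01; rewrite in_itv /= => /andP[c0 c1]; have c01 : 0 <= c <= 1 by rewrite !ltW.
rewrite dN; last by split; [exact: Db|rewrite /= b0 mulr_gt0].
rewrite b0 => eq0; exists c => //; rewrite bE.
have cm : c ^+ m != 0 by rewrite expf_neq0// gt_eqF.
have ym : y 0 0 ^+ m != 0 by rewrite expf_neq0// gt_eqF.
have m1 : m.+1%:R != 0 :> R by rewrite pnatr_eq0.
have ym1 : y 0 0 ^+ m.+1 != 0 by rewrite expf_neq0// (gt_eqF y0).
apply/eqP; rewrite eqr_div//; apply/eqP.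
apply: (mulIf cm); move: eq0; rewrite exprMn exprS => eq0.
apply/eqP; rewrite eq_sym -subr_eq0; apply/eqP; rewrite [RHS]eq0.
set hh := h _; ring.
Qed.

(** Near a boundary point [x] the mean value form replaces the quotient by a value of [h] at a point
    of the normal segment below [y], which lies in every box around [x] that contains [y]. *)
Lemma haverage_cont D m N h : hopen D -> haverage_spec D m N h ->
  forall x, D x -> hcont (haverage m N h) x.
Proof.
move=> oD aN x Dx; have [sN sh N0 dN] := aN.
have := hnbhs_self oD Dx; rewrite /half_space /= le_eqVlt => /orP[/eqP x0|x0]; last first.
  have oI := hopen_int oD.
  apply: (hcont_congr (D := hint D) (f := fun y => N y * (y 0 0 ^+ m.+1)^-1)) => //.
    by move=> y [Dy /= y0]; rewrite /haverage gt_eqF.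
  apply: (hs_cont oI) => //; apply: hsM => //.
    by apply: hs_sub sN => // y [].
  apply: hsV => //; last by apply: hsX => //; exact: hs_coord.
  by move=> y [_ y0]; rewrite expf_neq0// gt_eqF.
apply/hcontP => e e0.
have [r1 r10 r1P] := (hcontP _ _).1 (hs_cont oD sh Dx) e e0.
have [r2 r20 r2P] := hopen_box oD Dx.
exists (Num.min r1 r2); first by rewrite lt_min r10.
move=> y Hy bxy; have bxy1 : box x r1 y by apply: boxW bxy; rewrite ge_min lexx.
have bxy2 : box x r2 y by apply: boxW bxy; rewrite ge_min lexx orbT.
have hh z : H z -> box x r1 z -> `|h z / m.+1%:R - h x / m.+1%:R| < e.
  move=> Hz bz; rewrite -mulrBl normrM normfV normr_nat ltr_pdivrMr ?ltr0n//.
  by apply: lt_le_trans (r1P _ Hz bz) _; rewrite ler_peMr ?ler1n// ltW.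
rewrite {2}/haverage -x0 eqxx /haverage; case: ifPn => [_|yn0]; first exact: hh.
have y0 : 0 < y 0 0 by rewrite lt0r yn0.
have zb (s : R) : 0 <= s <= 1 -> forall r, box x r y -> box x r (y + ((s - 1) * y 0 0) *: delta_mx 0 0).
  move=> /andP[s0 s1] r b j; have := b j; rewrite moveE; case: eqP => [->|_]; last by rewrite mulr0 addr0.
  rewrite mulr1 -x0 !subr0 (gtr0_norm y0); apply: le_lt_trans.
  have -> : y 0 0 + (s - 1) * y 0 0 = s * y 0 0 by ring.
  by rewrite normrM (ger0_norm s0) (gtr0_norm y0); apply: ler_piMl => //; exact: ltW.
have zH (s : R) : 0 <= s <= 1 -> H (y + ((s - 1) * y 0 0) *: delta_mx 0 0).
  move=> /andP[s0 s1]; rewrite /half_space /= moveE eqxx mulr1.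
  have -> : y 0 0 + (s - 1) * y 0 0 = s * y 0 0 by ring.
  by rewrite mulr_ge0// ltW.
have [s s01 ->] := haverage_MVT oD aN y0 (fun s s01 => r2P _ (zH s s01) (zb s s01 _ bxy2)).
by apply: hh; [exact: zH|exact: zb].
Qed.

(** The reason for carrying a general [m]: the class is closed under differentiation. A tangential
    derivative acts on [N] and [h] and keeps [m]. The normal derivative of [N / x_0 ^ (m + 1)] has
    numerator [x_0 d_0 N - (m + 1) N], whose own normal derivative is [x_0 ^ (m + 1) d_0 h], so [m]
    rises by one. This is differentiation under the integral sign without the integral. *)
Lemma haverage_derivative D m N h i : hopen D -> haverage_spec D m N h ->
  exists m' N' h', haverage_spec D m' N' h' /\
    forall x, hint D x -> hder i (haverage m N h) x (haverage m' N' h' x).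
Proof.
move=> oD [sN sh N0 dN]; have oI := hopen_int oD.
have hN x : hint D x -> forall l, hder i N x l ->
    hder i (haverage m N h) x (l / x 0 0 ^+ m.+1 +
      N x * (- (m.+1%:R * x 0 0 ^+ m * (0 == i)%:R) / x 0 0 ^+ m.+1 ^+ 2)).
  move=> Ix l hl; have x0 : 0 < x 0 0 by case: Ix.
  apply: (hder_congr (D := hint D) (f := fun y => N y * (y 0 0 ^+ m.+1)^-1)) => //.
    by move=> y [Dy /= y0]; rewrite /haverage gt_eqF.
  apply: hderM => //; apply: hderV; first by rewrite expf_neq0// gt_eqF.
  exact: hder_coordX.
have dN2 x : hint D x -> hpartial i (hpartial 0 N) x =
    m%:R * x 0 0 ^+ m.-1 * (0 == i)%:R * h x + x 0 0 ^+ m * hpartial i h x.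
  move=> Ix; apply: hderE; first exact: hnbhs_self Ix.
  apply: (hder_congr (D := hint D) (f := fun y => y 0 0 ^+ m * h y)) => //.
    by move=> y /dN ->.
  by apply: hderM; [exact: hder_coordX|exact: hs_hder Ix.1].
have [i0|i0] := eqVneq (0 : 'I_n.+1) i; last first.
  exists m, (hpartial i N), (hpartial i h); split.
    split; [exact: hs_partial|exact: hs_partial| |].
      move=> x Dx x0; apply: hderE; first exact: hnbhs_self Dx.
      apply/hderP => e e0; have [r r0 rP] := hopen_box oD Dx.
      exists r => // t tr Ht; rewrite !N0//.
        by rewrite mulr0 !subr0 normr0 mulr_ge0// ltW.
      - by apply: rP => //; exact: box_move.
      - by rewrite moveE x0 (negbTE i0) mulr0 addr0.
    (* The specification constrains [hpartial 0 N] only in the interior, where the derivatives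
       commute. *)
    move=> x Ix; rewrite (hderE _ (hder_swap oD sN Ix)); last exact: hnbhs_self Ix.
    by rewrite dN2// (negbTE i0) mulr0 mul0r add0r.
  move=> x Ix; have x0 : 0 < x 0 0 by case: Ix.
  have := hN x Ix _ (hs_hder (i := i) sN Ix.1).
  by rewrite (negbTE i0) mulr0 oppr0 mul0r mulr0 addr0 /haverage gt_eqF.
subst i; exists m.+1, (fun x => x 0 0 * hpartial 0 N x - m.+1%:R * N x), (hpartial 0 h); split.
  have s1 : hsmooth D (fun x => x 0 0 * hpartial 0 N x).
    by apply: hsM => //; [exact: hs_coord|exact: hs_partial].
  have s2 : hsmooth D (fun x => - (m.+1%:R * N x)).
    by apply: hsN => //; apply: hsM => //; exact: hs_cst.
  split; [exact: hsD|exact: hs_partial| |].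
    by move=> x Dx x0; rewrite x0 N0// mul0r mulr0 subrr.
  move=> x Ix; apply: hderE; first exact: hnbhs_self Ix.
  have h1 := hderM (hder_coord (i:=0) (j:=0) x) (hs_hder (i := 0) (hs_partial 0 sN) Ix.1).
  have h2 := hderM (hder_cst 0 (- m.+1%:R) x) (hs_hder (i := 0) sN Ix.1).
  have := hderD h1 h2; rewrite eqxx dN2// eqxx dN// => h3.
  apply: (hder_congr oD Ix.1 _ (_ : hder 0 (fun y => y 0 0 * hpartial 0 N y + - m.+1%:R * N y) x _)).
    by move=> y _; rewrite mulNr.
  suff <- : 1%:R * (x 0 0 ^+ m * h x) + x 0 0 *
    (m%:R * x 0 0 ^+ m.-1 * 1%:R * h x + x 0 0 ^+ m * hpartial 0 h x) +
    (0 * N x + - m.+1%:R * (x 0 0 ^+ m * h x)) = x 0 0 ^+ m.+1 * hpartial 0 h x by [].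
  case: (m) => [|p] /=; first by rewrite expr0 expr1; ring.
  by rewrite -!natr1 !exprS; ring.
move=> x Ix; have x0 : 0 < x 0 0 by case: Ix.
have := hN x Ix _ (hs_hder (i := 0) sN Ix.1).
rewrite [haverage m.+1 _ _ x]/haverage (gt_eqF x0).
set a := (X in hder 0 _ x X -> _); set b := (X in _ -> hder 0 _ x X).
suff -> : a = b by [].
have xm : x 0 0 ^+ m != 0 by rewrite expf_neq0// gt_eqF.
rewrite /a /b eqxx mulr1 expr2 !exprS; field; rewrite xm gt_eqF//.
Qed.

Lemma haverage_smooth D m N h : hopen D -> haverage_spec D m N h ->
  hsmooth D (haverage m N h).
Proof.
move=> oD aN k; elim: k m N h aN => [|k IH] m N h aN.
  by apply/hCk0P => //; exact: haverage_cont aN.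
apply/hCkSP => //; split=> [|i]; first exact: haverage_cont aN.
have [m' [N' [h' [aN' dN]]]] := haverage_derivative i oD aN.
exists (haverage m' N' h'); last exact: IH.
move=> x Dx; apply: (hder_ext oD (haverage_cont oD aN) Dx) => //.
exact: haverage_cont aN' x Dx.
Qed.

Lemma hadamard D f : hopen D -> hsmooth D f -> (forall x, D x -> x 0 0 = 0 -> f x = 0) ->
  exists2 q, hsmooth D q & forall x, D x -> f x = x 0 0 * q x.
Proof.
move=> oD sf f0.
have af : haverage_spec D 0 f (hpartial 0 f).
  by split => //; [exact: hs_partial|move=> x _; rewrite mul1r].
exists (haverage 0 f (hpartial 0 f)); first exact: haverage_smooth.
move=> x Dx; rewrite /haverage; case: eqP => [x0|/eqP x0]; first by rewrite f0// x0 mul0r.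
by rewrite expr1 mulrC divfK.
Qed.

(** * Passing from the interior to the boundary by continuity *)

Lemma hcont_eq D f g x : hopen D -> D x -> hcont f x -> hcont g x ->
  (forall y, hint D y -> f y = g y) -> f x = g x.
Proof.
move=> oD Dx /hcontP fc /hcontP gc fg; apply/eqP; rewrite -subr_eq0 -normr_le0.
apply/ler_addgt0Pl => e e0; rewrite addr0; have e2 : 0 < e / 2 by rewrite divr_gt0.
have [r1 r10 r1P] := fc _ e2; have [r2 r20 r2P] := gc _ e2; have [r3 r30 r3P] := hopen_box oD Dx.
set m := Num.min r1 (Num.min r2 r3); have m0 : 0 < m by rewrite !lt_min r10 r20.
have [m1 m2 m3] : [/\ m <= r1, m <= r2 & m <= r3] by rewrite /m !ge_min !lexx !orbT.
have Hx := hnbhs_self oD Dx.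
pose y := x + (m / 2) *: delta_mx 0 0.
have m20 : 0 < m / 2 by rewrite divr_gt0.
have Hy : H y by apply: half_space_move => //; exact: ltW.
have yb : box x m y by apply: box_move; rewrite gtr0_norm//; lra.
have Iy : hint D y.
  split; first by apply: r3P => //; exact: boxW yb.
  by rewrite /= moveE eqxx mulr1 ltr_wpDl.
have a1 := r1P _ Hy (boxW m1 yb); have a2 := r2P _ Hy (boxW m2 yb).
have -> : f x - g x = (g y - g x) - (f y - f x) by rewrite (fg y Iy); ring.
by apply: le_trans (ler_normB _ _) _; lra.
Qed.

(** Boundary values are limits along the inward normal, which exist because the Lipschitz bound
    makes them Cauchy. The bound itself survives the limit and gives continuity of the extension in
    all directions. *)
Lemma lipschitz_ext x r f (L : R) : 0 < L ->
  (forall y z, box x r y -> 0 < y 0 0 -> box x r z -> 0 < z 0 0 ->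
    `|f z - f y| <= L * \sum_i `|z 0 i - y 0 i|) ->
  exists2 g, (forall y, H y -> box x r y -> hcont g y) &
    forall y, box x r y -> 0 < y 0 0 -> g y = f y.
Proof.
move=> L0 fL.
(* The same formula is used at interior points, where the Lipschitz bound identifies the limit with
   [f y]. *)
pose g y : R := lim (f (y + s *: delta_mx 0 0) @[s --> 0^'+]).
have distE (y z : E) (s : R) : \sum_i `|(z + s *: delta_mx 0 0) 0 i - (y + s *: delta_mx 0 0) 0 i| =
    \sum_i `|z 0 i - y 0 i|.
  by apply: eq_bigr => i _; rewrite !moveE; congr `| _ |; ring.
have distS (y : E) (s t : R) : \sum_i `|(y + s *: delta_mx 0 0) 0 i - (y + t *: delta_mx 0 0) 0 i| =
    `|s - t|.
  rewrite (bigD1 0)//= big1 => [|i i0].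
    by rewrite !moveE eqxx !mulr1 addr0; congr `| _ |; ring.
  by rewrite !moveE (negbTE i0) !mulr0 subrr normr0.
have inb y : H y -> box x r y -> exists2 d, 0 < d & forall s : R, 0 < s < d ->
    box x r (y + s *: delta_mx 0 0) /\ 0 < (y + s *: delta_mx 0 0) 0 0.
  move=> Hy by_; have [d d0 dP] := hopen_box (@hopen_boxI _ _ x r) (conj by_ Hy).
  exists d => // s /andP[s0 sd]; split; last by rewrite moveE eqxx mulr1 ltr_wpDl.
  have [] // := dP (y + s *: delta_mx 0 0).
    by apply: half_space_move => //; exact: ltW.
  by apply: box_move; rewrite gtr0_norm.
have gP y : H y -> box x r y -> forall e : R, 0 < e ->
    exists2 d, 0 < d & forall s : R, 0 < s < d -> `|g y - f (y + s *: delta_mx 0 0)| < e.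
  move=> Hy by_ e e0; have [d d0 dP] := inb y Hy by_.
  have gc : f (y + s *: delta_mx 0 0) @[s --> 0^'+] --> g y.
    apply: cauchy_cvg; apply: cauchy_exP => eps eps0.
    set s0 := Num.min d (eps / L) / 2.
    have m0 : 0 < Num.min d (eps / L) by rewrite lt_min d0 divr_gt0.
    have sm : 0 < s0 < Num.min d (eps / L) by rewrite /s0; lra.
    move: (sm); rewrite lt_min => /and3P[s00 s0d s0e].
    exists (f (y + s0 *: delta_mx 0 0)).
    rewrite /nbhs /= /at_right /within /= -nbhs_ballE.
    exists s0 => // s; rewrite /ball /= sub0r normrN => ss sp.
    rewrite gtr0_norm// in ss.
    have ds : 0 < s < d by rewrite sp (lt_trans ss).
    have [b1 p1] := dP s ds; have ds0 : 0 < s0 < d by rewrite s00.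
    have [b2 p2] := dP s0 ds0.
    apply: le_lt_trans (fL _ _ b1 p1 b2 p2) _; rewrite distS.
    rewrite mulrC -ltr_pdivlMr//; apply: lt_trans s0e.
    by rewrite gtr0_norm ?subr_gt0// ltrBlDr ltrDl.
  have /cvgrPdist_lt/(_ e e0) := gc.
  rewrite ?near_simpl /nbhs /= /at_right /within /= -nbhs_ballE => -[d' /= d'0 d'P].
  exists d' => // s /andP[s0 sd]; apply: d'P => //.
  by rewrite /ball /= sub0r normrN gtr0_norm.
have gL y z : H y -> box x r y -> H z -> box x r z -> `|g z - g y| <= L * \sum_i `|z 0 i - y 0 i|.
  move=> Hy by_ Hz bz; apply/ler_addgt0Pl => e e0; have e2 : 0 < e / 2 by rewrite divr_gt0.
  have [d1 d10 d1P] := gP y Hy by_ _ e2; have [d2 d20 d2P] := gP z Hz bz _ e2.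
  have [d3 d30 d3P] := inb y Hy by_; have [d4 d40 d4P] := inb z Hz bz.
  set m := Num.min (Num.min d1 d2) (Num.min d3 d4).
  have m0 : 0 < m by rewrite !lt_min d10 d20 d30.
  have [s0 sm] : 0 < m / 2 /\ m / 2 < m by lra.
  move: sm; rewrite {2}/m !lt_min => /andP[/andP[s1 s2] /andP[s3 s4]].
  have a1 := d1P (m / 2); rewrite s0 in a1; have {}a1 := a1 s1.
  have a2 := d2P (m / 2); rewrite s0 in a2; have {}a2 := a2 s2.
  have a3 := d3P (m / 2); rewrite s0 in a3; have {a3}[b3 p3] := a3 s3.
  have a4 := d4P (m / 2); rewrite s0 in a4; have {a4}[b4 p4] := a4 s4.
  have := fL _ _ b3 p3 b4 p4; rewrite distE => a5.
  have -> : g z - g y = (g z - f (z + (m / 2) *: delta_mx 0 0)) +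
    ((f (z + (m / 2) *: delta_mx 0 0) - f (y + (m / 2) *: delta_mx 0 0)) -
    (g y - f (y + (m / 2) *: delta_mx 0 0))) by ring.
  apply: le_trans (ler_normD _ _) _.
  have := ler_normB (f (z + (m / 2) *: delta_mx 0 0) - f (y + (m / 2) *: delta_mx 0 0))
    (g y - f (y + (m / 2) *: delta_mx 0 0)).
  lra.
exists g.
  move=> y Hy by_; apply/hcontP => e e0.
  have [d d0 dP] := hopen_box (@hopen_boxI _ _ x r) (conj by_ Hy).
  have n0 : 0 < L * n.+1%:R by rewrite mulr_gt0// ltr0n.
  have e20 : 0 < e / (L * n.+1%:R) / 2 by rewrite !divr_gt0.
  exists (Num.min d (e / (L * n.+1%:R) / 2)); first by rewrite lt_min d0.
  move=> z Hz bz; have [bz' _] : (box x r `&` H) z.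
    by apply: dP => //; apply: boxW bz; rewrite ge_min lexx.
  apply: le_lt_trans (gL y z Hy by_ Hz bz') _.
  apply: le_lt_trans (_ : L * \sum_(i < n.+1) (e / (L * n.+1%:R) / 2) < _).
    apply: ler_wpM2l; first exact: ltW.
    apply: ler_sum => i _.
    by apply: ltW; apply: lt_le_trans (bz i) _; rewrite ge_min lexx orbT.
  rewrite sumr_const card_ord.
  have -> : L * (e / (L * n.+1%:R) / 2 *+ n.+1) = e / 2.
    rewrite -[X in L * X = _]mulr_natr; field.
    by rewrite (gt_eqF L0) /=; rewrite -[1 + _]/(1 + n%:R) addrC natr1 pnatr_eq0.
  by lra.
move=> y by_ y0; have Hy : H y by exact: ltW.
apply/eqP; rewrite -subr_eq0 -normr_le0; apply/ler_addgt0Pl => e e0; rewrite addr0.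
have e2 : 0 < e / 2 by rewrite divr_gt0.
have [d1 d10 d1P] := gP y Hy by_ _ e2; have [d2 d20 d2P] := inb y Hy by_.
set m := Num.min (Num.min d1 d2) (e / 2 / L).
have m0 : 0 < m by rewrite !lt_min d10 d20 divr_gt0.
have [s0 sm] : 0 < m / 2 /\ m / 2 < m by lra.
move: sm; rewrite {2}/m !lt_min => /andP[/andP[s1 s2] s3].
have a1 := d1P (m / 2); rewrite s0 in a1; have {}a1 := a1 s1.
have a2 := d2P (m / 2); rewrite s0 in a2; have {a2}[b2 p2] := a2 s2.
have := fL _ _ by_ y0 b2 p2.
have := distS y (m / 2) 0; rewrite scale0r addr0 => ->; rewrite subr0 (gtr0_norm s0) => a3.
have a4 : L * (m / 2) < e / 2 by rewrite mulrC -ltr_pdivlMr.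
have -> : g y - f y = (g y - f (y + (m / 2) *: delta_mx 0 0)) +
  (f (y + (m / 2) *: delta_mx 0 0) - f y) by ring.
by apply: le_trans (ler_normD _ _) _; lra.
Qed.

End Hadamard.

(** * Boundary extension for linear systems *)

Section LinearSystems.
Context {R : realType} {n : nat}.
Local Notation E := 'rV[R]_n.+1.
Local Notation H := (@half_space R n).
Implicit Types (i j k : 'I_n.+1) (x y : E) (f g : E -> R) (D : set E).

Lemma hnbhs_bounded (J : finType) (F : J -> E -> R) x : (forall a, hcont (F a) x) ->
  exists2 C : R, 0 < C & exists2 r : R, 0 < r &
    forall y, H y -> box x r y -> forall a, `|F a y| <= C.
Proof.
move=> Fc; pose C := \sum_a (`|F a x| + 1) + 1.
have C0 : 0 < C by rewrite ltr_wpDl// sumr_ge0// => j _; rewrite addr_ge0.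
exists C => //; suff /hnbhsP : \forall y \near hnbhs x, forall a, `|F a y| <= C by [].
apply: filter_forall => j; apply/hnbhsP.
have [r r0 rP] := (hcontP _ _).1 (Fc j) 1 ltr01; exists r => // y Hy bxy.
have a1 := rP y Hy bxy.
have a2 : `|F j x| + 1 <= \sum_a (`|F a x| + 1).
  by rewrite (bigD1 j)//= lerDl sumr_ge0// => l _; rewrite addr_ge0.
have -> : F j y = F j x + (F j y - F j x) by ring.
by apply: le_trans (ler_normD _ _) _; rewrite /C; lra.
Qed.

Section ODE.
Variables (I : finType) (D : set E) (A : 'I_n.+1 -> I -> I -> E -> R) (u : I -> E -> R).
Hypothesis oD : hopen D.
Hypothesis sA : forall k a b, hsmooth D (A k a b).
Hypothesis cu : forall a y, hint D y -> hcont (u a) y.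
Hypothesis du : forall y, hint D y -> forall k a,
  hder k (u a) y (\sum_b A k a b y * u b y).

(* Gronwall on short segments normal to the boundary. *)
Lemma ode_bounded x : D x -> x 0 0 = 0 -> exists r, exists2 L : R, 0 < L &
  [/\ 0 < r, (forall y, H y -> box x r y -> D y) &
    forall y, box x r y -> 0 < y 0 0 -> forall k a,
      `|\sum_b A k a b y * u b y| <= L].
Proof.
move=> Dx x0; pose N : R := #|I|%:R.
have [|C C0 [r1 r10 r1P]] := @hnbhs_bounded ('I_n.+1 * I * I)%type
    (fun p => A p.1.1 p.1.2 p.2) x.
  by move=> [[k a] b]; exact: (hs_cont oD (sA k a b) Dx).
have [r2 r20 r2P] := hopen_box oD Dx.
have NC : 0 < N * C + 1 by rewrite ltr_wpDl// mulr_ge0// ?ler0n// ltW.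
(* [d] is the height of the segments. It is small enough that [d * (N * C) <= 1 / 2], which permits
   the absorption below; the [+ 1] keeps the denominator positive even when [I] is empty. *)
set d := Num.min (Num.min r1 r2) (N * C + 1)^-1 / 2.
have m0 : 0 < Num.min (Num.min r1 r2) (N * C + 1)^-1 by rewrite !lt_min r10 r20 invr_gt0.
have [d0 dm] : 0 < d /\ d < Num.min (Num.min r1 r2) (N * C + 1)^-1 by rewrite /d; lra.
have dNC : d * (N * C) <= 1 / 2.
  have : d <= (N * C + 1)^-1 / 2 by rewrite /d ler_pM2r// ge_min lexx orbT.
  move=> h; apply: le_trans (_ : d * (N * C + 1) <= _).
    by rewrite ler_pM2l// lerDl.
  apply: le_trans (ler_wpM2r (ltW NC) h) _.
  by rewrite mulrAC mulVf ?gt_eqF// mul1r.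
move: dm; rewrite !lt_min => /andP[/andP[d1 d2] _].
pose z := x + d *: delta_mx 0 0.
have z0 : z 0 0 = d by rewrite moveE x0 eqxx mulr1 add0r.
have Hx := hnbhs_self oD Dx.
have Dz : D z.
  apply: r2P; first by apply: half_space_move => //; exact: ltW.
  by apply: box_move; rewrite gtr0_norm.
have Iz : hint D z by split => //; rewrite /= z0.
have [M M0 [r3 r30 r3P]] := hnbhs_bounded (fun a => cu (a:=a) Iz).
set r := Num.min r3 d; have r0 : 0 < r by rewrite lt_min r30.
have [rr3 rd] : r <= r3 /\ r <= d by rewrite /r !ge_min !lexx orbT.
have bD y : H y -> box x r1 y -> box x r2 y -> D y by move=> Hy _; exact: r2P.
(* [M] bounds each component near the point [z] at height [d], where every segment ends. The factor
   2 comes from [W c <= N * M + W c / 2]. *)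
pose S := 2 * (N * M).
have S0 : 0 <= S by rewrite !mulr_ge0// ?ler0n// ltW.
have Asum y : H y -> box x r1 y -> forall k a,
    `|\sum_b A k a b y * u b y| <= C * \sum_b `|u b y|.
  move=> Hy by_ k a; rewrite mulr_sumr; apply: le_trans (ler_norm_sum _ _ _) _.
  by apply: ler_sum => b _; rewrite normrM ler_wpM2r//; exact: (r1P y Hy by_ (k, a, b)).
have uS y : box x r y -> 0 < y 0 0 -> \sum_a `|u a y| <= S.
  move=> by_ y0; pose t := d - y 0 0.
  have yr : y 0 0 < r by have := by_ 0; rewrite x0 subr0 gtr0_norm.
  have t0 : 0 < t by rewrite subr_gt0 (lt_le_trans yr).
  have seg (s : R) : 0 <= s <= 1 -> let p := y + (s * t) *: delta_mx 0 0 in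
      [/\ H p, 0 < p 0 0, box x r1 p & box x r2 p].
    move=> /andP[s0 s1] p.
    have p0 : p 0 0 = y 0 0 + s * t by rewrite moveE eqxx mulr1.
    have st : 0 <= s * t <= t.
      apply/andP; split; first by rewrite mulr_ge0// ltW.
      by apply: ler_piMl => //; exact: ltW.
    have pp : 0 < p 0 0 by rewrite p0; lra.
    have pb r' : d < r' -> box x r' p.
      move=> dr j; have [->|j0] := eqVneq j 0.
        by rewrite x0 subr0 gtr0_norm// p0; rewrite /t in st *; lra.
      rewrite moveE (negbTE j0) mulr0 addr0; apply: lt_trans (by_ j) _; lra.
    by split; [exact: ltW|by []|exact: pb|exact: pb].
  pose W (s : R) := \sum_a `|u a (y + (s * t) *: delta_mx 0 0)|.
  have segI (s : R) : 0 <= s <= 1 -> hint D (y + (s * t) *: delta_mx 0 0).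
    by move=> /seg[Hp p0 b1 b2]; split => //; exact: bD.
  have Wc : {within `[0, 1], continuous W}.
    apply/subspace_continuousP => s s01; rewrite /W.
    have -> : (fun s : R => \sum_a `|u a (y + (s * t) *: delta_mx 0 0)|) =
      \sum_a (fun s : R => `|u a (y + (s * t) *: delta_mx 0 0)|).
      by apply/funext => v; rewrite fct_sumE.
    elim/big_ind : _ => [|f g cf cg|a _]; [exact: cvg_cst|exact: cvgD|apply: cvg_norm].
    have /subspace_continuousP : {within `[0, 1], continuous
        (fun s : R => u a (y + (s * t) *: delta_mx 0 0))}.
      apply: hcont_line => v v01; split; first by have [] := seg v v01.
      exact: cu (segI v v01).
    by move=> h; exact: h.
  have [c c01 cmax] := EVT_max (@ler01 R) Wc.
  move: c01; rewrite in_itv /= => c01.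
  have WS : W c <= S.
    set p := y + (c * t) *: delta_mx 0 0.
    have [c0 c1] := andP c01.
    pose t' := (1 - c) * t.
    have t'0 : 0 <= t' by apply: mulr_ge0; [rewrite subr_ge0|exact: ltW].
    have t'd : t' <= d.
      apply: le_trans (_ : t <= _); last by rewrite /t lerBlDr lerDl ltW.
      by apply: ler_piMl; [exact: ltW|rewrite lerBlDr lerDl].
    have yt : p + t' *: delta_mx 0 0 = y + t *: delta_mx 0 0.
      by rewrite /p /t' -addrA -scalerDl; congr (_ + _ *: _); ring.
    have ua a : `|u a p| <= M + C * W c * d.
      have a1 : `|u a (y + t *: delta_mx 0 0)| <= M.
        have := seg 1; rewrite ler01 lexx mul1r => /(_ isT) [Hyt _ _ _].
        apply: r3P => // j; rewrite /z !moveE.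
        have [->|j0] := eqVneq j 0.
          rewrite x0 /t !mulr1.
          have -> : y 0 0 + (d - y 0 0) - (0 + d) = 0 by ring.
          by rewrite normr0.
        by rewrite !mulr0 !addr0; exact: lt_le_trans (by_ j) rr3.
      have a2 : `|u a (p + t' *: delta_mx 0 0) - u a p - t' * 0| <= (C * W c) * `|t'|.
        apply: hMVT_le => s /andP[s0 s1].
        have -> : p + (s * t') *: delta_mx 0 0 = y + ((c + s * (1 - c)) * t) *: delta_mx 0 0.
          by rewrite /p /t' -addrA -scalerDl; congr (_ + _ *: _); ring.
        have v01 : 0 <= c + s * (1 - c) <= 1.
          rewrite addr_ge0 ?mulr_ge0 ?subr_ge0//=.
          have : s * (1 - c) <= 1 * (1 - c) by rewrite ler_wpM2r// subr_ge0.
          lra.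
        have [Hv v0 v1 v2] := seg _ v01; split => //.
        exists (\sum_b A 0 a b (y + ((c + s * (1 - c)) * t) *: delta_mx 0 0) *
           u b (y + ((c + s * (1 - c)) * t) *: delta_mx 0 0)); first by apply: du; exact: segI.
        rewrite subr0; apply: le_trans (Asum _ Hv v1 _ _) _.
        rewrite ler_wpM2l ?(ltW C0)//.
        by have := cmax (c + s * (1 - c)); rewrite in_itv /= v01 => /(_ isT).
      rewrite yt mulr0 subr0 (ger0_norm t'0) in a2.
      have -> : u a p = u a (y + t *: delta_mx 0 0) - (u a (y + t *: delta_mx 0 0) - u a p) by ring.
      apply: le_trans (ler_normB _ _) _; apply: lerD => //; apply: le_trans a2 _.
      rewrite ler_wpM2l// mulr_ge0 ?(ltW C0)// sumr_ge0//.
    have : W c <= \sum_(a : I) (M + C * W c * d) by apply: ler_sum.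
    rewrite sumr_const -[#|_|]/#|I| -mulr_natr -/N.
    have W0 : 0 <= W c by rewrite sumr_ge0.
    have : d * (N * C) * W c <= 1 / 2 * W c by rewrite ler_wpM2r.
    have -> : (M + C * W c * d) * N = N * M + d * (N * C) * W c by ring.
    rewrite /S; lra.
  apply: le_trans WS; have := cmax 0; rewrite in_itv /= lexx ler01 => /(_ isT).
  by rewrite {1}/W mul0r scale0r addr0.
exists r, (C * S + 1); first by rewrite ltr_wpDl// mulr_ge0// ltW.
have rW y : box x r y -> box x r1 y /\ box x r2 y.
  by move=> b; split; apply: boxW b; lra.
split => //.
  by move=> y Hy /rW[]; exact: bD.
move=> y by_ y0 k a; have [b1 _] := rW y by_.
apply: le_trans (Asum y (ltW y0) b1 k a) _.
by rewrite ler_wpDr// ler_wpM2l ?(ltW C0)//; exact: uS.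
Qed.

(** Bounded derivatives make [u] Lipschitz, hence continuously extendable. Smoothness then follows
    by bootstrapping: the system expresses the derivatives through the extension itself, so they are
    as regular as it is, and they remain derivatives at the boundary by [hder_ext]. *)
Lemma ode_ext x : D x -> x 0 0 = 0 -> exists D' (v : I -> E -> R),
  [/\ hopen D', D' x, D' `<=` D, forall a, hsmooth D' (v a) &
     forall a y, hint D' y -> v a y = u a y].
Proof.
move=> Dx x0; have [r [L L0 [r0 rD uL]]] := ode_bounded Dx x0.
have Hx := hnbhs_self oD Dx.
have lip a y z : box x r y -> 0 < y 0 0 -> box x r z -> 0 < z 0 0 ->
    `|u a z - u a y| <= L * \sum_i `|z 0 i - y 0 i|.
  move=> by_ y0 bz z0.
  have -> : u a z - u a y = u a z - u a y - \sum_i 0 * (z 0 i - y 0 i).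
    by rewrite big1 ?subr0// => i _; rewrite mul0r.
  apply: (@hpath_le _ _ x r) => // p bp p0 i.
  exists (\sum_b A i a b p * u b p); last by rewrite subr0; exact: uL.
  by apply: du; split => //; apply: rD => //; exact: ltW.
have /choice[v vP] : forall a, exists v : E -> R,
    (forall y, H y -> box x r y -> hcont v y) /\
    (forall y, box x r y -> 0 < y 0 0 -> v y = u a y).
  by move=> a; have [v v1 v2] := lipschitz_ext L0 (lip a); exists v.
have oB := hopen_boxI (x := x) (r := r).
have sBD : box x r `&` H `<=` D by move=> y [by_ Hy]; exact: rD.
exists (box x r `&` H), v; split => //; first by split => //; exact: boxxx.
  move=> a k; elim: k a => [|k IH] a.
    by apply/hCk0P => // y [by_ Hy]; exact: (vP a).1.
  apply/hCkSP => //; split=> [y [by_ Hy]|i]; first exact: (vP a).1.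
  have kF : hCk k (box x r `&` H) (fun y => \sum_b A i a b y * v b y).
    apply: hCk_sum => // b; apply: hCkM => //.
    exact: hCk_sub (sA i a b k).
  exists (fun y => \sum_b A i a b y * v b y) => // y By.
  apply: (hder_ext (D := box x r `&` H) (F := fun y => \sum_b A i a b y * v b y)) => //.
  - by move=> z [bz Hz]; exact: (vP a).1.
  - exact: (hCk_cont oB kF).
  - move=> z [[bz Hz] z0].
    have Iz : hint D z by split => //; exact: rD.
    have := du (k:=i) (a:=a) Iz.
    have -> : \sum_b A i a b z * u b z = \sum_b A i a b z * v b z.
      by apply: eq_bigr => b _; rewrite (vP b).2.
    apply: (hder_congr (hopen_int oB)) => [//|w [[bw _] w0]].
    by rewrite (vP a).2.
by move=> a y [[by_ _] y0]; exact: (vP a).2.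
Qed.

End ODE.

End LinearSystems.

(** * Matrix-valued functions and matrix linear systems *)

Section MatrixCalculus.
Context {R : realType} {n : nat}.
Local Notation E := 'rV[R]_n.+1.
Local Notation H := (@half_space R n).
Implicit Types (i j k : 'I_n.+1) (x y : E) (f : E -> R) (D : set E) (p q s : nat).

Definition mxder p q k (A : E -> 'M[R]_(p, q)) x (L : 'M[R]_(p, q)) :=
  forall a b, hder k (fun y => A y a b) x (L a b).

Definition mxpartial p q k (A : E -> 'M[R]_(p, q)) x : 'M[R]_(p, q) :=
  \matrix_(a, b) hpartial k (fun y => A y a b) x.

Definition mxsmooth p q D (A : E -> 'M[R]_(p, q)) :=
  forall a b, hsmooth D (fun y => A y a b).

Lemma hder_eq k f x l l' : hder k f x l -> l = l' -> hder k f x l'.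
Proof. by move=> h <-. Qed.

Lemma hder_fun k (f g : E -> R) x l : hder k f x l -> (forall y, f y = g y) -> hder k g x l.
Proof. by move=> h /funext <-. Qed.

Lemma hder_sum (I : Type) (r : seq I) k (F : I -> E -> R) x (l : I -> R) :
  (forall a, hder k (F a) x (l a)) ->
  hder k (fun y => \sum_(a <- r) F a y) x (\sum_(a <- r) l a).
Proof.
move=> Fl; elim: r => [|a r IH].
  rewrite big_nil; apply: hder_fun (hder_cst k 0 x) _ => y; by rewrite big_nil.
rewrite big_cons; apply: hder_fun (hderD (Fl a) IH) _ => y; by rewrite big_cons.
Qed.

Lemma mxder_uniq p q k (A : E -> 'M[R]_(p, q)) x L L' : H x ->
  mxder k A x L -> mxder k A x L' -> L = L'.
Proof.
by move=> Hx hL hL'; apply/matrixP => a b; rewrite -(hderE Hx (hL a b)) (hderE Hx (hL' a b)).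
Qed.

Lemma mxder_congr p q k D (A A' : E -> 'M[R]_(p, q)) x L : hopen D -> D x ->
  (forall y, D y -> A y = A' y) -> mxder k A x L -> mxder k A' x L.
Proof.
by move=> oD Dx AA' hL a b; apply: (hder_congr oD Dx) (hL a b) => y Dy; rewrite AA'.
Qed.

Lemma mxder_cst p q k (M : 'M[R]_(p, q)) x : mxder k (fun=> M) x 0.
Proof. by move=> a b; rewrite mxE; exact: hder_cst. Qed.

Lemma mxderD p q k (A B : E -> 'M[R]_(p, q)) x L M : mxder k A x L -> mxder k B x M ->
  mxder k (fun y => A y + B y) x (L + M).
Proof.
move=> hL hM a b; rewrite mxE; apply: hder_fun (hderD (hL a b) (hM a b)) _ => y.
by rewrite mxE.
Qed.

Lemma mxderZ p q k f (A : E -> 'M[R]_(p, q)) x l L : hder k f x l -> mxder k A x L ->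
  mxder k (fun y => f y *: A y) x (l *: A x + f x *: L).
Proof.
move=> hl hL a b; rewrite !mxE; apply: hder_fun (hderM hl (hL a b)) _ => y.
by rewrite mxE.
Qed.

Lemma mxderM p q s k (A : E -> 'M[R]_(p, q)) (B : E -> 'M[R]_(q, s)) x L M :
  mxder k A x L -> mxder k B x M ->
  mxder k (fun y => A y *m B y) x (L *m B x + A x *m M).
Proof.
move=> hL hM a b; rewrite !mxE -big_split /=.
have := hder_sum (r:=index_enum 'I_q) (fun c => hderM (hL a c) (hM c b)).
by move=> h; apply: hder_fun h _ => y; rewrite mxE.
Qed.

Lemma mxder_tr p q k (A : E -> 'M[R]_(p, q)) x L : mxder k A x L ->
  mxder k (fun y => (A y)^T) x L^T.
Proof.
move=> hL a b; rewrite mxE; apply: hder_fun (hL b a) _ => y; by rewrite mxE.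
Qed.

Section Smooth.
Variables (D : set E) (oD : hopen D).

Lemma mxs_der p q (A : E -> 'M[R]_(p, q)) k x : mxsmooth D A -> D x ->
  mxder k A x (mxpartial k A x).
Proof. by move=> sA Dx a b; rewrite mxE; exact: hs_hder (sA a b) x Dx. Qed.

Lemma mxs_partial p q (A : E -> 'M[R]_(p, q)) k : mxsmooth D A -> mxsmooth D (mxpartial k A).
Proof.
move=> sA a b; apply: (hs_congr oD (f := hpartial k (fun y => A y a b))).
  by move=> y _; rewrite mxE.
exact: hs_partial.
Qed.

Lemma mxs_congr p q (A B : E -> 'M[R]_(p, q)) : (forall y, D y -> A y = B y) ->
  mxsmooth D A -> mxsmooth D B.
Proof. by move=> AB sA a b; apply: hs_congr (sA a b) => // y Dy; rewrite AB. Qed.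

Lemma mxs_cst p q (M : 'M[R]_(p, q)) : mxsmooth D (fun=> M).
Proof. by move=> a b; exact: hs_cst. Qed.

Lemma mxsD p q (A B : E -> 'M[R]_(p, q)) : mxsmooth D A -> mxsmooth D B ->
  mxsmooth D (fun y => A y + B y).
Proof.
move=> sA sB a b; apply: (hs_congr oD (f := fun y => A y a b + B y a b)).
  by move=> y _; rewrite mxE.
exact: hsD.
Qed.

Lemma mxsZ p q f (A : E -> 'M[R]_(p, q)) : hsmooth D f -> mxsmooth D A ->
  mxsmooth D (fun y => f y *: A y).
Proof.
move=> sf sA a b; apply: (hs_congr oD (f := fun y => f y * A y a b)).
  by move=> y _; rewrite mxE.
exact: hsM.
Qed.

Lemma mxsN p q (A : E -> 'M[R]_(p, q)) : mxsmooth D A -> mxsmooth D (fun y => - A y).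
Proof.
move=> sA; apply: (@mxs_congr _ _ (fun y => -1 *: A y)) => [y _|].
  by rewrite scaleN1r.
by apply: mxsZ => //; exact: hs_cst.
Qed.

Lemma mxsM p q s (A : E -> 'M[R]_(p, q)) (B : E -> 'M[R]_(q, s)) :
  mxsmooth D A -> mxsmooth D B -> mxsmooth D (fun y => A y *m B y).
Proof.
move=> sA sB a b; apply: (hs_congr oD (f := fun y => \sum_c A y a c * B y c b)).
  by move=> y _; rewrite mxE.
by apply: hs_sum => // c; exact: hsM.
Qed.

Lemma mxs_tr p q (A : E -> 'M[R]_(p, q)) : mxsmooth D A -> mxsmooth D (fun y => (A y)^T).
Proof.
move=> sA a b; apply: (hs_congr oD (f := fun y => A y b a)) => // y _; by rewrite mxE.
Qed.

Lemma hs_prod (I : Type) (r : seq I) (F : I -> E -> R) :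
  (forall a, hsmooth D (F a)) -> hsmooth D (fun y => \prod_(a <- r) F a y).
Proof.
move=> sF; elim: r => [|a r IH].
  by apply: (hs_congr oD (f := fun=> 1)) => [y _|]; [rewrite big_nil|exact: hs_cst].
apply: (hs_congr oD (f := fun y => F a y * \prod_(a <- r) F a y)).
  by move=> y _; rewrite big_cons.
exact: hsM.
Qed.

Lemma hs_det p (A : E -> 'M[R]_p) : mxsmooth D A -> hsmooth D (fun y => \det (A y)).
Proof.
move=> sA; rewrite /determinant; apply: hs_sum => // t.
by apply: hsM => //; [exact: hs_cst|exact: hs_prod].
Qed.

Lemma mxsV p (A : E -> 'M[R]_p) : (forall y, D y -> A y \in unitmx) -> mxsmooth D A ->
  mxsmooth D (fun y => invmx (A y)).
Proof.
move=> uA sA; apply: (@mxs_congr _ _ (fun y => (\det (A y))^-1 *: \adj (A y))) => [y Dy|].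
  by rewrite /invmx uA.
apply: mxsZ; first by apply: hsV => //; [move=> y /uA; rewrite unitmxE unitfE|exact: hs_det].
move=> a b; apply: (hs_congr oD (f := fun y => cofactor (A y) b a)) => [y _|].
  by rewrite mxE.
apply: hsM => //; first exact: hs_cst.
by apply: hs_det => c d; apply: (hs_congr oD (f := fun y => A y (lift b c) (lift a d))) => // y _;
  rewrite !mxE.
Qed.

Lemma mxder_inv p k (A : E -> 'M[R]_p) x L : (forall y, D y -> A y \in unitmx) ->
  mxsmooth D A -> D x -> mxder k A x L ->
  mxder k (fun y => invmx (A y)) x (- (invmx (A x) *m L *m invmx (A x))).
Proof.
move=> uA sA Dx hL.
(* Cramer's rule has already shown that the inverse is smooth, so its derivative [V] exists and
   differentiating [A * A^-1 = 1] identifies it. *)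
have hV := mxs_der (k:=k) (mxsV uA sA) Dx; set V := mxpartial _ _ _ in hV.
suff <- : V = - (invmx (A x) *m L *m invmx (A x)) by [].
have h1 := mxderM hL hV.
have h0 : mxder k (fun y => A y *m invmx (A y)) x 0.
  apply: (mxder_congr oD Dx) (mxder_cst k (1%:M) x) => y Dy.
  by rewrite mulmxV// uA.
have := mxder_uniq (hnbhs_self oD Dx) h0 h1.
move=> /(congr1 (mulmx (invmx (A x)))); rewrite mulmx0 mulmxDr mulKmx ?uA// => /esym/eqP.
by rewrite addrC addr_eq0 => /eqP ->; rewrite mulmxA.
Qed.

End Smooth.

Lemma mxsmooth_sub D D' p q (A : E -> 'M[R]_(p, q)) : D' `<=` D ->
  mxsmooth D A -> mxsmooth D' A.
Proof. by move=> sD sA a b; exact: hs_sub (sA a b). Qed.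

Lemma mx_hcont_eq D p q (A B : E -> 'M[R]_(p, q)) x : hopen D -> D x -> mxsmooth D A ->
  mxsmooth D B -> (forall y, hint D y -> A y = B y) -> A x = B x.
Proof.
move=> oD Dx sA sB AB; apply/matrixP => a b.
by apply: (hcont_eq (f := fun y => A y a b) (g := fun y => B y a b) oD Dx (hs_cont oD (sA a b) Dx)
  (hs_cont oD (sB a b) Dx)) => y /AB ->.
Qed.

Lemma ode_mx_ext D x (P Q : 'I_n.+1 -> E -> 'M[R]_n.+1) (U : E -> 'M[R]_n.+1) :
  hopen D -> D x -> x 0 0 = 0 -> (forall k, mxsmooth D (P k)) -> (forall k, mxsmooth D (Q k)) ->
  mxsmooth (hint D) U ->
  (forall k y, hint D y -> mxder k U y (P k y *m U y + U y *m Q k y)) ->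
  exists D' (V : E -> 'M[R]_n.+1), [/\ hopen D', D' x, D' `<=` D, mxsmooth D' V &
     forall y, hint D' y -> V y = U y].
Proof.
move=> oD Dx x0 sP sQ sU dU; have oI := hopen_int oD.
(* The matrix of [U |-> P U + U Q] acting on the entries of [U], indexed by pairs: the sum of two
   Kronecker products with the identity. *)
pose A k (c d : 'I_n.+1 * 'I_n.+1) y : R :=
  P k y c.1 d.1 * (d.2 == c.2)%:R + (d.1 == c.1)%:R * Q k y d.2 c.2.
have [|||D' [v [oD' D'x sD' sv vu]]] := @ode_ext _ _ _ D A (fun c y => U y c.1 c.2) oD _ _ _ x Dx x0.
- move=> k c d; apply: hsD => //; apply: hsM => //; first exact: sP.
  + exact: hs_cst.
  + exact: hs_cst.
  + exact: sQ.
- by move=> c y Iy; exact: (hs_cont oI (sU c.1 c.2) Iy).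
- move=> y Iy k [i j] /=; apply: hder_eq (dU k y Iy i j) _.
  rewrite !mxE (eq_bigr (fun d : 'I_n.+1 * 'I_n.+1 => P k y i d.1 * (d.2 == j)%:R * U y d.1 d.2 +
     (d.1 == i)%:R * Q k y d.2 j * U y d.1 d.2)); last by move=> d _; rewrite /A mulrDl.
  rewrite big_split /= -(pair_bigA _ (fun a b => P k y i a * (b == j)%:R * U y a b)).
  rewrite -(pair_bigA _ (fun a b => (a == i)%:R * Q k y b j * U y a b)) /=; congr (_ + _).
    apply: eq_bigr => a _; rewrite (bigD1 j)//= eqxx mulr1 big1 ?addr0// => b bj.
    by rewrite (negbTE bj) mulr0 mul0r.
  rewrite [RHS](bigD1 i)//= [X in _ + X]big1 ?addr0 => [|a ai].
    by apply: eq_bigr => b _; rewrite eqxx mul1r mulrC.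
  by rewrite big1// => b _; rewrite (negbTE ai) !mul0r.
exists D', (fun y => \matrix_(i, j) v (i, j) y); split => //.
  by move=> i j; apply: (hs_congr oD' (f := v (i, j))) => // y _; rewrite mxE.
by move=> y Iy; apply/matrixP => i j; rewrite mxE vu.
Qed.

End MatrixCalculus.

(** * Algebra of projective changes *)

Section MetricAlgebra.
Context {R : realType} {m : nat}.
Implicit Types (K S G B gi : 'M[R]_m) (r Y X : 'rV[R]_m) (e z : 'cV[R]_m) (rho f c : R).

(* For [e] the [k]-th coordinate vector, this is the matrix added to the symbols of the
   covariant derivative in direction [k] by the projective change with one-form [Y]. *)
Definition projterm e Y : 'M[R]_m := (Y *m e) 0 0 *: 1%:M + e *m Y.

Lemma projtermZ e a Y : projterm e (a *: Y) = a *: projterm e Y.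
Proof. by rewrite /projterm -scalemxAl mxE -scalemxAr -scalerA scalerDr. Qed.

Lemma projtermD e Y Y' : projterm e (Y + Y') = projterm e Y + projterm e Y'.
Proof. by rewrite /projterm mulmxDl mxE scalerDl mulmxDr addrACA. Qed.

Lemma projtermE (k a b : 'I_m) Y :
  projterm (delta_mx k 0) Y a b = Y 0 k * (a == b)%:R + Y 0 b * (a == k)%:R.
Proof.
rewrite /projterm [LHS]mxE; congr (_ + _).
  rewrite mxE [1%:M _ _]mxE; congr (_ * _).
  rewrite mxE (bigD1 k)//= mxE !eqxx mulr1 big1 ?addr0// => i ik.
  by rewrite mxE (negbTE ik) mulr0.
by rewrite mxE big_ord1 mxE eqxx andbT mulrC.
Qed.

Lemma mx11_mul_tr p (u : 'rV[R]_p) (v : 'cV[R]_p) : (u *m v) 0 0 = (v^T *m u^T) 0 0.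
Proof. by rewrite -trmx_mul [in RHS]mxE. Qed.

Lemma mx11_mul (p q : nat) (u : 'M[R]_(p, 1)) (a : 'M[R]_1) (v : 'M[R]_(1, q)) :
  u *m a *m v = a 0 0 *: (u *m v).
Proof. by rewrite [a]mx11_scalar mxE eqxx mulr1n mul_mx_scalar -scalemxAl. Qed.

Lemma projterm_quad e Y r X :
  (r *m projterm e Y *m X^T) 0 0 =
  (Y *m e) 0 0 * (r *m X^T) 0 0 + (r *m e) 0 0 * (Y *m X^T) 0 0.
Proof.
rewrite /projterm mulmxDr mulmxDl mxE -scalemxAr mulmx1 -scalemxAl mxE; congr (_ + _).
by rewrite mulmxA -mulmxA {1}[r *m e]mx11_scalar mul_scalar_mx mxE.
Qed.

(** The left side is the product rule for [rho^-2 gi], where [gi] is differentiated as the inverse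
    of a metric parallel for [G]. The singular terms [c / rho] from the factor [rho^-2] and from the
    projective term of [G] cancel exactly when the coefficient of the latter is [rho^-1], which is
    where order one enters. *)
Lemma scaled_inverse_derivative e G Gh gi r Y rho : rho != 0 -> gi^T = gi ->
  r *m gi = rho ^+ 4 *: Y -> G = Gh - rho^-1 *: projterm e r ->
  let S := (rho * rho)^-1 *: gi in let c := (r *m e) 0 0 in
  (- (c * rho + rho * c) / (rho * rho) ^+ 2) *: gi + (rho * rho)^-1 *: (- (gi *m G^T) - G *m gi) =
  - (Gh *m S)^T - Gh *m S + rho *: (e *m Y + (e *m Y)^T).
Proof.
move=> rho0 gis rgi GE S c.
have -> : gi *m G^T = (G *m gi)^T by rewrite trmx_mul gis.
have -> : G *m gi = Gh *m gi - rho^-1 *: (c *: gi + rho ^+ 4 *: (e *m Y)).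
  rewrite GE mulmxBl -scalemxAl /projterm mulmxDl -scalemxAl mul1mx -mulmxA rgi.
  by rewrite -scalemxAr.
rewrite /S -scalemxAr; move: (Gh *m gi) (e *m Y) => A1 A2.
apply/matrixP => a b; rewrite !mxE.
have -> : gi b a = gi a b by rewrite -[in LHS]gis mxE.
by field.
Qed.

(** The left side has the form [A + A^T], and [A = B K] is what has to be matched. A product [u Y]
    with a column [u] equals [(u r) K], so [z] collects these columns: [f Gh Y^T] compensates for
    [- Gh K] in place of [- Gh S], and [df / 2] appears because its term is already symmetric. *)
Lemma linear_system_for_K e Gh S r Y dY rho f df : S^T = S ->
  let K := S + f *: (Y^T *m Y) in r *m K = Y ->
  let z := rho *: e + f *: (Gh *m Y^T) + (df / 2) *: Y^T + f *: dY^T in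
  let B := z *m r - Gh in
  - (Gh *m S)^T - Gh *m S + rho *: (e *m Y + (e *m Y)^T) +
    (df *: (Y^T *m Y) + f *: (dY^T *m Y + Y^T *m dY)) = B *m K + K *m B^T.
Proof.
move=> Ss K rK z B.
have Ks : K^T = K by rewrite /K linearD linearZ /= trmx_mul trmxK Ss.
have -> : K *m B^T = (B *m K)^T by rewrite trmx_mul Ks.
have -> : B *m K = - (Gh *m S) + rho *: (e *m Y) + (df / 2) *: (Y^T *m Y) + f *: (dY^T *m Y).
  rewrite /B mulmxBl -mulmxA rK /z !mulmxDl -!scalemxAl /K mulmxDr -scalemxAr mulmxA.
  move: (Gh *m S) (e *m Y) (Gh *m Y^T *m Y) (Y^T *m Y) (dY^T *m Y) => A1 A2 A3 A4 A5.
  by apply/matrixP => a b; rewrite !mxE; ring.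
have -> : Y^T *m dY = (dY^T *m Y)^T by rewrite trmx_mul trmxK.
have := trmx_mul Y^T Y; rewrite trmxK.
move: (Gh *m S) (e *m Y) (Y^T *m Y) (dY^T *m Y) => A1 A2 A4 A5 A4s.
apply/matrixP => a b; rewrite !mxE.
have -> : A4 b a = A4 a b by rewrite -[in LHS]A4s mxE.
by field.
Qed.

(** From [gi r^T = rho^4 Y^T] and [Y g = rho^-4 r], every product except [gi g] is a multiple of the
    single matrix [Y^T r], and the scalar coefficients add up to zero. *)
Lemma inverse_of_K g gi r Y rho nu : rho != 0 -> nu != 0 -> gi *m g = 1%:M -> gi^T = gi ->
  r *m gi = rho ^+ 4 *: Y -> (Y *m r^T) 0 0 = nu ->
  ((rho * rho)^-1 *: gi + ((1 - rho * rho) / nu) *: (Y^T *m Y)) *m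
  ((rho * rho) *: g - (nu^-1 / (rho * rho)) *: (r^T *m r) + nu^-1 *: (r^T *m r)) = 1%:M.
Proof.
move=> rho0 nu0 gig gis rgi Yr.
have Yg : Y *m g = (rho ^+ 4)^-1 *: r.
  have -> : Y = (rho ^+ 4)^-1 *: (r *m gi) by rewrite rgi scalerA mulVf ?expf_neq0// scale1r.
  by rewrite -scalemxAl -mulmxA gig mulmx1.
have E1 : gi *m (r^T *m r) = rho ^+ 4 *: (Y^T *m r).
  have : gi *m r^T = rho ^+ 4 *: Y^T by rewrite -[gi]gis -trmx_mul rgi linearZ.
  by rewrite mulmxA => ->; rewrite -scalemxAl.
have E2 : Y^T *m Y *m g = (rho ^+ 4)^-1 *: (Y^T *m r) by rewrite -mulmxA Yg -scalemxAr.
have E3 : Y^T *m Y *m (r^T *m r) = nu *: (Y^T *m r).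
  by rewrite mulmxA -(mulmxA Y^T) mx11_mul Yr.
rewrite mulmxDl !mulmxDr !mulmxN -!scalemxAl -!scalemxAr gig E1 E2 E3.
move: (Y^T *m r) => A; apply/matrixP => a b; rewrite !mxE; move: (_ == _) => t.
by field; rewrite rho0 nu0.
Qed.

(** The hypotheses on [dr] and [dX] are the derivatives of [r = rho^3 X g] and of [X r^T = rho nu];
    [dX r^T] is eliminated between them. Of the 4, three come from [rho^3] and one from [rho nu].
    Metric compatibility yields [r G X^T] twice, and the projective term of [G] contributes
    [- 2 beta c nu] to each. *)
Lemma order_one_identity (g G Gh : 'M[R]_m) e r X dr dX rho nu dnu beta :
  rho != 0 -> g^T = g ->
  r = (rho * (rho * rho)) *: (X *m g) -> (X *m r^T) 0 0 = rho * nu ->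
  let c := (r *m e) 0 0 in
  G = Gh - (beta / rho) *: projterm e r ->
  dr = (c * (rho * rho) + rho * (c * rho + rho * c)) *: (X *m g) +
     (rho * (rho * rho)) *: (dX *m g + X *m (G^T *m g + g *m G)) ->
  (dX *m r^T + X *m dr^T) 0 0 = c * nu + rho * dnu ->
  2 * ((dr - r *m Gh) *m X^T) 0 0 = 4 * (1 - beta) * c * nu + rho * dnu.
Proof.
move=> rho0 gs rE Xr c GE drE dXr.
have addE (A B : 'M[R]_1) : (A + B) 0 0 = A 0 0 + B 0 0 by rewrite mxE.
have subE (A B : 'M[R]_1) : (A - B) 0 0 = A 0 0 - B 0 0 by rewrite !mxE.
have Xr' : (r *m X^T) 0 0 = rho * nu by rewrite -Xr mx11_mul_tr trmxK.
have Xdr : (X *m dr^T) 0 0 = (dr *m X^T) 0 0.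
  by rewrite mx11_mul_tr trmxK.
have gX : (rho * (rho * rho)) *: (g *m X^T) = r^T.
  by rewrite rE linearZ /= trmx_mul gs.
have r3 : rho * (rho * rho) != 0 by rewrite !mulf_neq0.
have XgX : (X *m g *m X^T) 0 0 = nu / (rho * rho).
  have : (r *m X^T) 0 0 = (rho * (rho * rho)) * (X *m g *m X^T) 0 0.
    by rewrite {1}rE -scalemxAl mxE.
  rewrite Xr' => h; apply: (mulfI r3); rewrite -h; field; exact: rho0.
have cE : (r *m G *m X^T) 0 0 = (r *m Gh *m X^T) 0 0 - 2 * beta * c * nu.
  rewrite GE mulmxBr mulmxBl mxE [in X in _ + X]mxE -scalemxAr -scalemxAl [in X in _ - X]mxE.
  by rewrite projterm_quad Xr' -/c; field.
have drX : (dr *m X^T) 0 0 = 3 * c * nu + (dX *m r^T) 0 0 + 2 * (r *m G *m X^T) 0 0.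
  have e1 : (rho * (rho * rho)) * (dX *m g *m X^T) 0 0 = (dX *m r^T) 0 0.
    by rewrite -gX -scalemxAr [RHS]mxE mulmxA.
  have e2 : (rho * (rho * rho)) * (X *m (g *m G) *m X^T) 0 0 = (r *m G *m X^T) 0 0.
    by rewrite rE -!scalemxAl [RHS]mxE !mulmxA.
  have e3 : (rho * (rho * rho)) * (X *m (G^T *m g) *m X^T) 0 0 = (r *m G *m X^T) 0 0.
    rewrite -e2; congr (_ * _); rewrite mx11_mul_tr !trmx_mul !trmxK gs.
    by rewrite !mulmxA.
  rewrite drE mulmxDl mxE -!scalemxAl [in X in X + _]mxE [in X in _ + X]mxE XgX.
  rewrite mulmxDl addE mulmxDr mulmxDl addE !mulrDr e1 e2 e3.
  by field.
move: dXr; rewrite addE Xdr mulmxBl subE => dXr.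
rewrite cE in drX; lra.
Qed.

End MetricAlgebra.

(** * The metric near a boundary point *)

Section BoundaryNormalForm.
Context {R : realType} {n : nat}.
Local Notation E := 'rV[R]_n.+1.
Local Notation H := (@half_space R n).
Implicit Types (i j k : 'I_n.+1) (x y : E) (f rho nu : E -> R) (D : set E).

Definition hgrad f y : 'rV[R]_n.+1 := \row_i hpartial i f y.

Definition hdefining D rho :=
  [/\ hsmooth D rho, forall y, D y -> (rho y = 0 <-> y 0 0 = 0) &
     forall y, D y -> y 0 0 = 0 -> hgrad rho y != 0].

Lemma hgradE f y k : (hgrad f y *m delta_mx k 0 : 'M[R]_1) 0 0 = hpartial k f y.
Proof.
rewrite mxE (bigD1 k)//= !mxE !eqxx mulr1 big1 ?addr0// => i ik.
by rewrite !mxE (negbTE ik) mulr0.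
Qed.

Lemma mxs_hgrad D f : hopen D -> hsmooth D f -> mxsmooth D (hgrad f).
Proof.
move=> oD sf a b; apply: (hs_congr oD (f := hpartial b f)); last exact: hs_partial.
by move=> y _; rewrite mxE.
Qed.

(** The quotient [q] has no zero: in the interior [rho] is non-zero, and on the boundary
    [d rho = q dx_0]. Division by [rho] thus reduces to division by [x_0], and [d rho / rho] is
    [dx_0 / x_0] up to a smooth one-form. *)
Lemma hdefining_factor D rho : hopen D -> hdefining D rho -> exists2 q, hsmooth D q &
  forall y, D y -> [/\ rho y = y 0 0 * q y, q y != 0 &
    hgrad rho y = q y *: delta_mx 0 0 + y 0 0 *: hgrad q y].
Proof.
move=> oD [srho rho0 drho].
have [q sq qE] := hadamard oD srho (fun y Dy hy => proj2 (rho0 y Dy) hy).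
exists q => // y Dy.
have gE : hgrad rho y = q y *: delta_mx 0 0 + y 0 0 *: hgrad q y.
  apply/rowP => i; rewrite !mxE eqxx /=.
  have := hderM (hder_coord (i:=i) (j:=0) y) (hs_hder (i:=i) sq Dy).
  move=> /(hder_congr oD Dy (fun z Dz => esym (qE z Dz))).
  move=> /(hderE (hnbhs_self oD Dy)) ->.
  by rewrite mulrC eq_sym.
split => //; first exact: qE.
apply/eqP => q0; have y0 : y 0 0 = 0 by apply/rho0 => //; rewrite qE// q0 mulr0.
by have := drho y Dy y0; rewrite gE q0 y0 !scale0r addr0 eqxx.
Qed.

Section Core.
Variables (D : set E) (x : E).
Hypotheses (oD : hopen D) (Dx : D x) (x0 : x 0 0 = 0).
Variables (g : E -> 'M[R]_n.+1) (Gam : 'I_n.+1 -> E -> 'M[R]_n.+1).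
Hypothesis sg : mxsmooth (hint D) g.
Hypothesis gs : forall y, hint D y -> (g y)^T = g y.
Hypothesis gu : forall y, hint D y -> g y \in unitmx.
Hypothesis dg : forall k y, hint D y ->
  mxder k g y ((Gam k y)^T *m g y + g y *m Gam k y).
Variables (rho nu : E -> R) (X : E -> 'rV[R]_n.+1).
Hypothesis rho_def : hdefining D rho.
Hypothesis snu : hsmooth D nu.
Hypothesis nu0 : forall y, D y -> nu y != 0.
Hypothesis sX : mxsmooth D X.
Hypothesis X0 : forall y, D y -> y 0 0 = 0 -> X y = 0.
Hypothesis XE : forall y, hint D y -> X y = rho y ^- 3 *: (hgrad rho y *m invmx (g y)).
Hypothesis nuE : forall y, hint D y ->
  nu y = rho y ^- 4 * (hgrad rho y *m invmx (g y) *m (hgrad rho y)^T) 0 0.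

Let oI : hopen (hint D). Proof. exact: hopen_int. Qed.
Let srho : hsmooth D rho. Proof. by case: rho_def. Qed.
Let r := hgrad rho.
Let e k : 'cV[R]_n.+1 := delta_mx k 0.
Let sr : mxsmooth D r. Proof. exact: mxs_hgrad. Qed.

Let intD y : hint D y -> D y. Proof. by case. Qed.

Let rho_neq0 y : hint D y -> rho y != 0.
Proof.
case: rho_def => _ h _ [Dy /= y0]; apply/eqP => /(h y Dy).1 e0.
by rewrite e0 ltxx in y0.
Qed.

Let rho_bdry y : D y -> y 0 0 = 0 -> rho y = 0.
Proof. by case: rho_def => _ h _ Dy /(h y Dy).2. Qed.

Let r_bdry : exists2 q : R, q != 0 & r x = q *: delta_mx 0 0.
Proof.
have [q sq qE] := hdefining_factor oD rho_def; have [_ q0 gE] := qE x Dx.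
by exists (q x) => //; rewrite /r gE x0 scale0r addr0.
Qed.

Let XrE y : D y -> (X y *m (r y)^T) 0 0 = rho y * nu y.
Proof.
move=> Dy; apply: (hcont_eq (f := fun y => (X y *m (r y)^T) 0 0) (g := fun y => rho y * nu y) oD Dy).
- exact: (hs_cont oD (mxsM oD sX (mxs_tr oD sr) 0 0) Dy).
- exact: (hs_cont oD (hsM oD srho snu) Dy).
move=> z Iz; rewrite XE// nuE// -/(r z) -scalemxAl mxE.
by set b := (r z *m invmx (g z) *m (r z)^T) 0 0; field; exact: rho_neq0.
Qed.

Let rXg y : hint D y -> r y = (rho y * (rho y * rho y)) *: (X y *m g y).
Proof.
move=> Iy; rewrite XE// -scalemxAl mulmxKV ?gu// scalerA.
have -> : rho y * (rho y * rho y) / rho y ^+ 3 = 1 by field; exact: rho_neq0.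
by rewrite scale1r.
Qed.

Lemma order_one beta (Gh : 'I_n.+1 -> E -> 'M[R]_n.+1) :
  (forall k, mxsmooth D (Gh k)) ->
  (forall k y, hint D y -> Gam k y = Gh k y - (beta / rho y) *: projterm (e k) (r y)) ->
  beta = 1.
Proof.
move=> sGh GhE.
(* Direction 0 is the one that determines [beta]: at [x] the covector [r] is a non-zero multiple of
   [delta_mx 0 0], so the other directions give no information there. *)
pose lhs y : R := 2 * ((mxpartial 0 r y - r y *m Gh 0 y) *m (X y)^T) 0 0.
pose rhs y : R := 4 * (1 - beta) * hpartial 0 rho y * nu y + rho y * hpartial 0 nu y.
have slhs : hsmooth D lhs.
  apply: hsM => //; first exact: hs_cst.
  apply: (mxsM oD _ (mxs_tr oD sX)); apply: mxsD => //; first exact: mxs_partial.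
  by apply: mxsN => //; exact: mxsM.
have srhs : hsmooth D rhs.
  apply: hsD => //; apply: hsM => //; last exact: hs_partial.
  by apply: hsM => //; [exact: hs_cst|exact: hs_partial].
have : lhs x = rhs x.
  apply: (hcont_eq oD Dx (hs_cont oD slhs Dx) (hs_cont oD srhs Dx)) => y Iy.
  have Dy := intD Iy; have Hy := hnbhs_self oD Dy.
  have hr := hs_hder (i:=0) srho Dy; have hnu := hs_hder (i:=0) snu Dy.
  have hdr := mxs_der (k:=0) sr Dy; have hdX := mxs_der (k:=0) sX Dy.
  have := order_one_identity (e := e 0) (rho := rho y) (g := g y) (G := Gam 0 y)
    (Gh := Gh 0 y) (r := r y) (X := X y) (dr := mxpartial 0 r y) (dX := mxpartial 0 X y)
    (nu := nu y) (dnu := hpartial 0 nu y) (beta := beta).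
  rewrite /= hgradE; apply => //.
  - exact: rho_neq0.
  - exact: gs.
  - exact: rXg.
  - exact: XrE.
  - exact: GhE.
  - apply: (mxder_uniq Hy hdr).
    apply: (mxder_congr oI Iy (A := fun y => (rho y * (rho y * rho y)) *: (X y *m g y))).
      by move=> z /rXg.
    apply: mxderZ; first exact: hderM hr (hderM hr hr).
    exact: (mxderM hdX (dg Iy)).
  - have h1 := mxderM hdX (mxder_tr hdr).
    have h2 := hderM hr hnu; rewrite -(hderE Hy (h1 0 0)); apply: (hderE Hy).
    by apply: (hder_congr oD Dy _ h2) => z Dz; rewrite XrE.
rewrite /lhs /rhs X0// rho_bdry// trmx0 mulmx0 mxE mulr0 mul0r addr0.
have [q q0 rx] := r_bdry; have -> : hpartial 0 rho x = q.
  by rewrite -[LHS]hgradE -/(r x) rx -scalemxAl mxE mul_delta_mx mxE !eqxx mulr1.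
move=> /esym/eqP; rewrite !mulf_eq0 (negbTE q0) (negbTE (nu0 Dx)) pnatr_eq0 /= !orbF.
by rewrite subr_eq0 => /eqP.
Qed.

Let divided_X : exists2 Y : E -> 'rV[R]_n.+1, mxsmooth D Y &
  forall y, D y -> X y = rho y *: Y y.
Proof.
have [q sq qE] := hdefining_factor oD rho_def.
have /choice[Z ZP] : forall i, exists Z : E -> R, hsmooth D Z /\
    forall y, D y -> X y 0 i = y 0 0 * Z y.
  move=> i; have [|Z sZ ZE] := hadamard oD (sX 0 i); last by exists Z.
  by move=> y Dy y0; rewrite X0// mxE.
exists (fun y => (q y)^-1 *: \row_i Z i y).
  apply: mxsZ => //; first by apply: hsV => // y /qE[].
  by move=> a b; apply: (hs_congr oD (f := Z b)) => [y _|]; [rewrite mxE|have [] := ZP b].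
move=> y Dy; have [-> q0 _] := qE y Dy; apply/rowP => i; rewrite !mxE.
by rewrite (ZP i).2//; field.
Qed.

Lemma boundary_form (Gh : 'I_n.+1 -> E -> 'M[R]_n.+1) :
  (forall k, mxsmooth D (Gh k)) ->
  (forall k y, hint D y -> Gam k y = Gh k y - (rho y)^-1 *: projterm (e k) (r y)) ->
  exists D' (h : E -> 'M[R]_n.+1), [/\ hopen D', D' x, D' `<=` D, mxsmooth D' h &
    (forall y, hint D' y -> h y = rho y ^+ 2 *: g y -
       ((nu y)^-1 / rho y ^+ 2) *: ((r y)^T *m r y)) /\
    (forall v : 'rV[R]_n.+1, v 0 0 = 0 ->
       (forall w : 'rV[R]_n.+1, w 0 0 = 0 -> (v *m h x *m w^T) 0 0 = 0) -> v = 0)].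
Proof.
move=> sGh GhE; have [Y sY YE] := divided_X.
pose f y := (1 - rho y * rho y) / nu y.
have sf : hsmooth D f.
  by apply: hsM => //; [apply: hsB => //; [exact: hs_cst|exact: hsM]|exact: hsV].
pose gi y := invmx (g y).
pose S y := (rho y * rho y)^-1 *: gi y.
pose K y := S y + f y *: ((Y y)^T *m Y y).
pose L y := (rho y * rho y) *: g y - ((nu y)^-1 / (rho y * rho y)) *: ((r y)^T *m r y)
  + (nu y)^-1 *: ((r y)^T *m r y).
pose z k y := rho y *: e k + f y *: (Gh k y *m (Y y)^T) + (hpartial k f y / 2) *: (Y y)^T
   + f y *: (mxpartial k Y y)^T.
pose B k y := z k y *m r y - Gh k y.
have sYT := mxs_tr oD sY.
have sB k : mxsmooth D (B k).
  apply: mxsD => //; last exact: mxsN.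
  apply: mxsM => //; apply: mxsD => //; last first.
    by apply: mxsZ => //; apply: mxs_tr => //; exact: mxs_partial.
  apply: mxsD => //; last first.
    apply: mxsZ => //; apply: hsM => //; [exact: hs_partial|exact: hs_cst].
  apply: mxsD => //; apply: mxsZ => //; [exact: mxs_cst|exact: mxsM].
have gis y : hint D y -> (gi y)^T = gi y.
  by move=> Iy; rewrite /gi trmx_inv gs.
have rgi y : hint D y -> r y *m gi y = rho y ^+ 4 *: Y y.
  move=> Iy; have r0 := rho_neq0 Iy.
  have -> : r y *m gi y = rho y ^+ 3 *: X y.
    by rewrite XE// scalerA mulfV ?expf_neq0// scale1r.
  by rewrite YE ?scalerA -?exprSr//; exact: intD.
have Yr y : D y -> (Y y *m (r y)^T) 0 0 = nu y.
  move=> Dy; apply: (hcont_eq (f := fun y => (Y y *m (r y)^T) 0 0) oD Dy).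
  - exact: (hs_cont oD (mxsM oD sY (mxs_tr oD sr) 0 0) Dy).
  - exact: (hs_cont oD snu Dy).
  move=> w Iw; have := XrE (intD Iw); rewrite YE; last exact: intD.
  by rewrite -scalemxAl mxE => /(mulfI (rho_neq0 Iw)).
have sgi : mxsmooth (hint D) gi by exact: mxsV.
have sub p q (A : E -> 'M[R]_(p, q)) : mxsmooth D A -> mxsmooth (hint D) A.
  by apply: mxsmooth_sub.
have hsub (F : E -> R) : hsmooth D F -> hsmooth (hint D) F by apply: hs_sub.
have rr0 y : hint D y -> rho y * rho y != 0.
  by move=> Iy; rewrite mulf_neq0// rho_neq0.
have sS : mxsmooth (hint D) S.
  by apply: mxsZ => //; apply: hsV => //; apply: hsub; exact: hsM.
have sK : mxsmooth (hint D) K.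
  by apply: mxsD => //; apply: sub; apply: mxsZ => //; exact: mxsM.
have Ss y : hint D y -> (S y)^T = S y by move=> Iy; rewrite /S linearZ /= gis.
have rK y : hint D y -> r y *m K y = Y y.
  move=> Iy; have Dy := intD Iy; rewrite /K mulmxDr -!scalemxAr rgi// mulmxA.
  rewrite [r y *m (Y y)^T]mx11_scalar mx11_mul_tr trmxK Yr// mul_scalar_mx !scalerA -scalerDl.
  suff -> : (rho y * rho y)^-1 * rho y ^+ 4 + f y * nu y = 1 by rewrite scale1r.
  by rewrite /f; field; rewrite nu0// rho_neq0.
have dK k y : hint D y -> mxder k K y (B k y *m K y + K y *m (B k y)^T).
  move=> Iy; have Dy := intD Iy; have r0 := rho_neq0 Iy.
  have hr := hs_hder (i:=k) srho Dy.
  have h1 := mxder_inv oI gu sg Iy (dg (k:=k) Iy).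
  have h2 := hderV (rr0 _ Iy) (hderM hr hr).
  have h3 := mxderZ h2 h1.
  have hY := mxs_der (k:=k) sY Dy.
  have h4 := mxderZ (hs_hder (i:=k) sf Dy) (mxderM (mxder_tr hY) hY).
  have := mxderD h3 h4.
  set M1 := (X in mxder k _ y X -> _); set M2 := (X in _ -> mxder k _ y X).
  suff -> : M1 = M2 by [].
  rewrite /M1 /M2 -(linear_system_for_K (e k) (Gh k y) (mxpartial k Y y) (rho y)
     (hpartial k f y) (Ss y Iy) (rK y Iy)); congr (_ + _).
  have E1 : invmx (g y) *m ((Gam k y)^T *m g y + g y *m Gam k y) *m invmx (g y) =
     gi y *m (Gam k y)^T + Gam k y *m gi y.
    by rewrite mulmxDr mulmxDl -/(gi y) !mulmxA mulVmx ?gu// mul1mx -!mulmxA mulmxV ?gu// mulmx1.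
  rewrite E1 [- (gi y *m _ + _)]opprD -/(gi y).
  have := scaled_inverse_derivative r0 (gis y Iy) (rgi y Iy) (GhE k y Iy).
  by rewrite /= hgradE => ->.
have KL y : hint D y -> K y *m L y = 1%:M.
  move=> Iy; apply: inverse_of_K; [exact: rho_neq0|exact/nu0/intD| |exact: gis|exact: rgi|].
    by rewrite /gi mulVmx// gu.
  exact/Yr/intD.
have uK y : hint D y -> K y \in unitmx by move=> /KL /mulmx1_unit[].
have LE y : hint D y -> L y = invmx (K y).
  by move=> Iy; rewrite -[LHS](mulKmx (uK y Iy)) KL// mulmx1.
have sL : mxsmooth (hint D) L.
  by apply: (mxs_congr oI (A := fun y => invmx (K y))) => [y /LE ->//|]; exact: mxsV.
have dL k y : hint D y -> mxder k L y ((- (B k y)^T) *m L y + L y *m (- B k y)).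
  move=> Iy; apply: (mxder_congr oI Iy (A := fun y => invmx (K y))) => [w /LE//|].
  have := mxder_inv oI uK sK Iy (dK k y Iy).
  by rewrite LE// mulmxDr mulmxDl !mulmxA mulVmx ?uK// mul1mx -!mulmxA mulmxV ?uK// mulmx1
    opprD addrC mulNmx mulmxN.
have sBT k : mxsmooth D (fun y => (B k y)^T) by exact: mxs_tr.
(* It is not known beforehand that the extension of [K] is invertible at [x], so [L] is extended
   through its own system and not as the inverse of [K']. *)
have [D1 [K' [oD1 D1x D1D sK' K'E]]] := ode_mx_ext oD Dx x0 sB sBT sK dK.
have [D2 [L' [oD2 D2x D2D sL' L'E]]] := ode_mx_ext oD Dx x0
  (fun k => mxsN oD (sBT k)) (fun k => mxsN oD (sB k)) sL dL.
pose D' := D1 `&` D2; have oD' : hopen D' by exact: hopenI.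
have D'D : D' `<=` D by move=> y [/D1D].
have I1 y : hint D' y -> hint D1 y by move=> [[]].
have I2 y : hint D' y -> hint D2 y by move=> [[]].
have I3 y : hint D' y -> hint D y by move=> [/D'D].
have D'x : D' x by [].
have sK1 : mxsmooth D' K' by apply: mxsmooth_sub sK' => // y [].
have sL1 : mxsmooth D' L' by apply: mxsmooth_sub sL' => // y [].
have sr1 : mxsmooth D' r by apply: mxsmooth_sub sr.
have sY1 : mxsmooth D' Y by apply: mxsmooth_sub sY.
have snu1 : hsmooth D' nu by apply: hs_sub snu.
have sV1 : hsmooth D' (fun y => (nu y)^-1) by apply: hsV => // y /D'D; exact: nu0.
exists D', (fun y => L' y - (nu y)^-1 *: ((r y)^T *m r y)); split => //.
  apply: mxsD => //; apply: mxsN => //; apply: mxsZ => //.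
  by apply: mxsM => //; exact: mxs_tr.
split=> [y Iy|v v0 vw]; first by rewrite (L'E _ (I2 _ Iy)) /L addrK !expr2.
have KLx : K' x *m L' x = 1%:M.
  apply: (mx_hcont_eq (A := fun y => K' y *m L' y) (B := fun=> 1%:M) oD' D'x).
  - exact: mxsM.
  - exact: mxs_cst.
  - by move=> y Iy; rewrite (K'E _ (I1 _ Iy)) (L'E _ (I2 _ Iy)) KL//; exact: I3.
have YLx : Y x *m L' x = r x.
  apply: (mx_hcont_eq (A := fun y => Y y *m L' y) (B := r) oD' D'x) => //.
    exact: mxsM.
  move=> y Iy; rewrite (L'E _ (I2 _ Iy)) -(rK _ (I3 _ Iy)) -mulmxA KL ?mulmx1//.
  exact: I3.
have [q q0 rx] := r_bdry.
have vr : v *m (r x)^T = 0.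
  apply/matrixP => a b; rewrite !ord1 rx linearZ /= -scalemxAr trmx_delta !mxE.
  rewrite big1 ?mulr0// => i _; rewrite !mxE.
  by have [->|i0] := eqVneq i 0; rewrite ?v0 ?mul0r ?mulr0.
(* Testing with [w = e_i] for [i != 0] leaves only component 0 of [v L'], and [r x = q e_0]. The
   tensor [h] may be replaced by [L'] because [r] annihilates the tangent vector [v]. *)
have vL : v *m L' x = ((v *m L' x) 0 0 / q) *: r x.
  apply/rowP => i; rewrite rx scalerA divfK// [RHS]mxE [delta_mx _ _ _ _]mxE eqxx /=.
  have [->|i0] := eqVneq i 0; first by rewrite mulr1.
  have := vw (delta_mx 0 i); rewrite mxE eqxx eq_sym (negbTE i0) => /(_ erefl).
  have -> : v *m (L' x - (nu x)^-1 *: ((r x)^T *m r x)) = v *m L' x.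
    by rewrite mulmxBr -scalemxAr mulmxA vr mul0mx scaler0 subr0.
  rewrite mulr0 => <-; rewrite trmx_delta [RHS]mxE (bigD1 i)//= [delta_mx _ _ _ _]mxE !eqxx mulr1.
  by rewrite big1 ?addr0// => j ji; rewrite [delta_mx _ _ _ _]mxE (negbTE ji) mulr0.
set lam := _ / q in vL.
have LK : L' x *m K' x = 1%:M by apply: mulmx1C.
have vY : v = lam *: Y x.
  rewrite -[v]mulmx1 -LK mulmxA vL -YLx -scalemxAl -(mulmxA (Y x)) LK mulmx1 //.
move: vr; rewrite vY -scalemxAl => /matrixP/(_ 0 0).
rewrite mxE Yr// mxE => /eqP; rewrite mulf_eq0 (negbTE (nu0 Dx)) orbF => /eqP ->.
by rewrite scale0r.
Qed.

Lemma core_extension (alpha : R) (Gam1 : 'I_n.+1 -> E -> 'M[R]_n.+1) (rho1 : E -> R) :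
  alpha != 0 -> hdefining D rho1 -> (forall k, mxsmooth D (Gam1 k)) ->
  (forall k y, hint D y ->
     Gam1 k y = Gam k y + projterm (e k) ((alpha * rho1 y)^-1 *: hgrad rho1 y)) ->
  exists D' (h : E -> 'M[R]_n.+1), [/\ hopen D', D' x, D' `<=` D, mxsmooth D' h &
    (forall y, hint D' y -> h y = rho y ^+ 2 *: g y -
       ((nu y)^-1 / rho y ^+ 2) *: ((r y)^T *m r y)) /\
    (forall v : 'rV[R]_n.+1, v 0 0 = 0 ->
       (forall w : 'rV[R]_n.+1, w 0 0 = 0 -> (v *m h x *m w^T) 0 0 = 0) -> v = 0)].
Proof.
move=> a0 rho1_def sG1 G1E.
have [q sq qE] := hdefining_factor oD rho_def.
have [q1 sq1 q1E] := hdefining_factor oD rho1_def.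
(* Formally [alpha^-1 d log (q1 / q)]: the singular part [dx_0 / x_0] is common to both defining
   functions and drops out of the difference. *)
pose s y := alpha^-1 *: ((q1 y)^-1 *: hgrad q1 y - (q y)^-1 *: hgrad q y).
pose Gh k y := Gam1 k y - projterm (e k) (s y).
have ss : mxsmooth D s.
  apply: mxsZ => //; first exact: hs_cst.
  apply: mxsD => //; [|apply: mxsN => //]; apply: mxsZ => //.
  - by apply: hsV => // y /q1E[].
  - exact: mxs_hgrad.
  - by apply: hsV => // y /qE[].
  - exact: mxs_hgrad.
have sGh k : mxsmooth D (Gh k).
  apply: mxsD => //; apply: mxsN => //; apply: mxsD => //.
    by apply: mxsZ => //; [apply: (mxsM oD ss); exact: mxs_cst|exact: mxs_cst].
  by apply: mxsM => //; exact: mxs_cst.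
have GhE k y : hint D y -> Gam k y = Gh k y - (alpha^-1 / rho y) *: projterm (e k) (r y).
  move=> Iy; have [Dy /= y0] := Iy; have [rE q0 gE] := qE y Dy; have [r1E q10 g1E] := q1E y Dy.
  rewrite /Gh G1E// -projtermZ.
  have -> : (alpha * rho1 y)^-1 *: hgrad rho1 y = s y + (alpha^-1 / rho y) *: r y.
    have yn0 : y 0 0 != 0 by rewrite gt_eqF.
    rewrite /s /r gE g1E rE r1E; apply/rowP => i; rewrite !mxE.
    by field; rewrite a0 q0 q10 yn0.
  rewrite projtermD; move: (Gam k y) (projterm _ _) (projterm _ _) => A1 A2 A3.
  by apply/matrixP => a b; rewrite !mxE; ring.
have b1 := order_one sGh GhE.
apply: (boundary_form sGh) => k y Iy; rewrite GhE// b1 mul1r //.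
Qed.

End Core.

End BoundaryNormalForm.

(** * Gluing of local extensions, and composition *)

Section Gluing.
Context {R : realType} {n : nat}.
Local Notation E := 'rV[R]_n.+1.
Local Notation H := (@half_space R n).
Implicit Types (i j k : 'I_n.+1) (x y z : E) (f : E -> R) (D : set E).

(** No partition of unity is needed: each point takes the value of its own local extension, and two
    local extensions agree on their overlap because they agree in the interior and are
    continuous. *)
Lemma mxsmooth_glue D p q (F : E -> 'M[R]_(p, q)) : hopen D ->
  (forall x, D x -> exists D' (h : E -> 'M[R]_(p, q)),
     [/\ hopen D', D' x, D' `<=` D, mxsmooth D' h & forall y, hint D' y -> h y = F y]) ->
  exists2 G : E -> 'M[R]_(p, q), mxsmooth D G & forall y, hint D y -> G y = F y.
Proof.
move=> oD FD.
have /choice[Dh DhP] : forall x, exists Dh : set E * (E -> 'M[R]_(p, q)), D x ->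
    [/\ hopen Dh.1, Dh.1 x, Dh.1 `<=` D, mxsmooth Dh.1 Dh.2 & forall y, hint Dh.1 y -> Dh.2 y = F y].
  move=> x; have [Dx|nDx] := pselect (D x); last by exists (set0, fun=> 0).
  by have [D' [h P]] := FD x Dx; exists (D', h).
exists (fun x => (Dh x).2 x) => [a b|y [Dy y0]]; last first.
  by have [_ Dyy _ _ ->] := DhP y Dy.
apply: hs_loc => // x Dx; have [oD' D'x D'D sh hF] := DhP x Dx.
exists (Dh x).1; split => //; apply: (hs_congr oD' _ (sh a b)) => y D'y.
have [oD'' D''y _ sh' hF'] := DhP y (D'D y D'y).
have oI := hopenI oD' oD''; congr (fun_of_matrix _ a b).
have Iy : ((Dh x).1 `&` (Dh y).1) y by split.
apply: (mx_hcont_eq (A := (Dh x).2) (B := (Dh y).2) oI Iy).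
- by apply: mxsmooth_sub sh => // w [].
- by apply: mxsmooth_sub sh' => // w [].
- by move=> w [[w1 w2] w0]; rewrite hF ?hF'.
Qed.

Lemma hcont_comp D (phi : E -> E) f x : hopen D -> D x ->
  (forall j, hcont (fun y => phi y 0 j) x) -> (forall y, D y -> H (phi y)) ->
  hcont f (phi x) -> hcont (f \o phi) x.
Proof.
move=> oD Dx phic Hphi /hcontP fc; apply/hcontP => e e0; have [r r0 rP] := fc e e0.
have : \forall y \near hnbhs x, forall j, `|phi y 0 j - phi x 0 j| < r.
  apply: filter_forall => j; apply/hnbhsP.
  by have [r' r'0 r'P] := (hcontP _ _).1 (phic j) r r0; exists r'.
move=> /hnbhsP[r1 r10 r1P]; have [r2 r20 r2P] := hopen_box oD Dx.
exists (Num.min r1 r2); first by rewrite lt_min r10.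
move=> y Hy bxy; apply: rP.
  by apply: Hphi; apply: r2P => //; apply: boxW bxy; rewrite ge_min lexx orbT.
by move=> j; apply: r1P => //; apply: boxW bxy; rewrite ge_min lexx.
Qed.

Lemma hcont_sum (I : Type) (s : seq I) (F : I -> E -> R) x :
  (forall a, hcont (F a) x) -> hcont (fun y => \sum_(a <- s) F a y) x.
Proof.
move=> Fc; elim: s => [|a s IH].
  have -> : (fun y : E => \sum_(a <- [::]) F a y) = fun=> 0.
    by apply/funext => y; rewrite big_nil.
  exact: cvg_cst.
have -> : (fun y : E => \sum_(b <- a :: s) F b y) = fun y => F a y + \sum_(b <- s) F b y.
  by apply/funext => y; rewrite big_cons.
exact: hcontD.
Qed.

(** Continuity of the partial derivatives of [f] gives a first-order expansion along coordinate
    paths, so [phi] only needs a derivative in direction [i]. The image point is interior, which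
    keeps these paths where the mean value estimate applies. *)
Lemma hder_comp D D' (phi : E -> E) f x i (J : 'I_n.+1 -> R) :
  hopen D -> D x -> (forall j, hder i (fun y => phi y 0 j) x (J j)) ->
  hopen D' -> hint D' (phi x) -> (forall y, D y -> H (phi y)) -> hsmooth D' f ->
  hder i (f \o phi) x (\sum_j J j * hpartial j f (phi x)).
Proof.
move=> oD Dx dphi oD' Iz Hphi sf; set z := phi x in Iz *.
apply/hderP => e e0.
pose C1 := \sum_j (`|J j| + 1); pose C2 := \sum_j `|hpartial j f z| + 1.
have C10 : 0 < C1.
  rewrite /C1 (bigD1 ord0)//=; apply: ltr_pwDl; first by rewrite ltr_wpDl.
  by rewrite sumr_ge0// => j _; rewrite addr_ge0.
have C20 : 0 < C2 by rewrite ltr_wpDl// sumr_ge0.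
(* Two errors of size [e / 2 * |t|]: [e1] controls the variation of the partial derivatives over a
   displacement of at most [C1 * |t|], and [e2] the linearisation of [phi], weighted by [C2].
   Capping [e2] at 1 is what gives the bound with [C1]. *)
have e10 : 0 < e / 2 / C1 by rewrite !divr_gt0.
have e20 : 0 < Num.min 1 (e / 2 / C2) by rewrite lt_min ltr01 !divr_gt0.
set e1 := e / 2 / C1 in e10 *; set e2 := Num.min _ _ in e20 *.
have : \forall y \near hnbhs z, forall j, `|hpartial j f y - hpartial j f z| < e1.
  apply: filter_forall => j; apply/hnbhsP.
  have [r r0 rP] := (hcontP _ _).1 (hs_cont oD' (hs_partial j sf) Iz.1) e1 e10.
  by exists r.
move=> /hnbhsP[r1 r10 r1P]; have [r2 r20 r2P] := hopen_box (hopen_int oD') Iz.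
set r := Num.min r1 r2; have r0 : 0 < r by rewrite lt_min r10.
have [rr1 rr2] : r <= r1 /\ r <= r2 by rewrite /r !ge_min !lexx orbT.
have : \forall t \near (0 : R), forall j, H (x + t *: delta_mx 0 i) ->
    `|phi (x + t *: delta_mx 0 i) 0 j - z 0 j - t * J j| <= e2 * `|t|.
  pose P j t := H (x + t *: delta_mx 0 i) ->
    `|phi (x + t *: delta_mx 0 i) 0 j - z 0 j - t * J j| <= e2 * `|t|.
  apply: (@filter_forall _ _ P (nbhs (0 : R)) _) => j.
  have [d d0 dP] := (hderP _ _ _ _).1 (dphi j) e2 e20.
  apply/nbhs_ballP; exists d => // t; rewrite /ball /= sub0r normrN => td.
  exact: dP.
move=> /nbhs_ballP[d /= d0 dP]; have [r3 r30 r3P] := hopen_box oD Dx.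
have m0 : 0 < Num.min d (Num.min r3 (r / C1)) by rewrite !lt_min d0 r30 divr_gt0.
exists (Num.min d (Num.min r3 (r / C1))) => // t; rewrite !lt_min => /and3P[td t3 tr] Ht.
set w := phi (x + t *: delta_mx 0 i).
have wd j : `|w 0 j - z 0 j - t * J j| <= e2 * `|t|.
  by apply: dP => //; rewrite /ball /= sub0r normrN.
have e21 : e2 <= 1 by rewrite /e2 ge_min lexx.
have wz j : `|w 0 j - z 0 j| <= (`|J j| + 1) * `|t|.
  have -> : w 0 j - z 0 j = (w 0 j - z 0 j - t * J j) + t * J j by ring.
  apply: le_trans (ler_normD _ _) _; rewrite normrM mulrDl mul1r addrC [`|t| * _]mulrC lerD2l.
  by apply: le_trans (wd j) _; rewrite ler_piMl.
have wzs : \sum_j `|w 0 j - z 0 j| <= C1 * `|t| by rewrite mulr_suml ler_sum.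
have wb : box z r w.
  move=> j; apply: le_lt_trans (_ : C1 * `|t| < r); last by rewrite mulrC -ltr_pdivlMr.
  apply: le_trans wzs; rewrite (bigD1 j)//= lerDl sumr_ge0//.
have Hw : H w by apply: Hphi; apply: r3P => //; exact: box_move.
have Iw : hint D' w by apply: r2P => //; exact: boxW wb.
have z0 : 0 < z 0 0 by case: Iz.
have pw : `|f w - f z - \sum_j hpartial j f z * (w 0 j - z 0 j)| <=
    e1 * \sum_j `|w 0 j - z 0 j|.
  apply: (@hpath_le _ _ z r) => //; [|exact: boxxx|by case: Iw].
  move=> y yb y0 j; have Hy : H y by exact: ltW.
  have Iy : hint D' y by apply: r2P => //; exact: boxW yb.
  exists (hpartial j f y); first exact: (hs_hder (i:=j) sf Iy.1).
  by apply/ltW/r1P => //; exact: boxW yb.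
have -> : (f \o phi) (x + t *: delta_mx 0 i) - (f \o phi) x - t * (\sum_j J j * hpartial j f z) =
  (f w - f z - \sum_j hpartial j f z * (w 0 j - z 0 j)) +
  \sum_j hpartial j f z * (w 0 j - z 0 j - t * J j).
  rewrite /= -/w -/z; have -> : \sum_j hpartial j f z * (w 0 j - z 0 j - t * J j) =
    \sum_j hpartial j f z * (w 0 j - z 0 j) - t * (\sum_j J j * hpartial j f z).
    by rewrite mulr_sumr -sumrB; apply: eq_bigr => j _; ring.
  ring.
apply: le_trans (ler_normD _ _) _.
have -> : e * `|t| = e / 2 * `|t| + e / 2 * `|t| by field.
apply: lerD.
  apply: le_trans pw _; apply: le_trans (ler_wpM2l (ltW e10) wzs) _.
  by rewrite mulrA /e1 divfK ?gt_eqF.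
apply: le_trans (ler_norm_sum _ _ _) _.
apply: le_trans (_ : \sum_j `|hpartial j f z| * (e2 * `|t|) <= _).
  by apply: ler_sum => j _; rewrite normrM ler_wpM2l.
rewrite -mulr_suml mulrA ler_wpM2r//.
apply: le_trans (_ : C2 * (e / 2 / C2) <= _); last by rewrite mulrC divfK ?gt_eqF.
apply: ler_pM; [exact: sumr_ge0|exact: ltW|by rewrite /C2 lerDl|by rewrite /e2 ge_min lexx orbT].
Qed.

(** At an interior point both signs of the step are allowed, and minimality bounds [s * l] below by
    [- e * t] for [s = t] and for [s = - t]. *)
Lemma hder_min D i f y l : hopen D -> hint D y -> hder i f y l -> f y = 0 ->
  (forall z, D z -> 0 <= f z) -> l = 0.
Proof.
move=> oD Iy /hderP fl fy f0; apply/eqP; rewrite -normr_le0.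
apply/ler_addgt0Pl => e e0; rewrite addr0; have [r1 r10 r1P] := fl e e0.
have [r2 r20 r2P] := hopen_box oD Iy.1; have y0 : 0 < y 0 0 by case: Iy.
set m := Num.min (y 0 0) (Num.min r1 r2); have m0 : 0 < m by rewrite !lt_min y0 r10.
have [t0 tm] : 0 < m / 2 /\ m / 2 < m by lra.
move: tm; set t := m / 2 in t0 *; rewrite /m !lt_min => /and3P[ty t1 t2].
have bd (s : R) : `|s| = t -> 0 <= f (y + s *: delta_mx 0 i) /\
    `|f (y + s *: delta_mx 0 i) - s * l| <= e * t.
  move=> st; have Hs : H (y + s *: delta_mx 0 i).
    have := box_move y i (r := y 0 0) (t := s); rewrite st => /(_ ty 0).
    rewrite /half_space /= ltr_norml; lra.
  split; first by apply/f0/r2P => //; apply: box_move; rewrite st.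
  by have := r1P s; rewrite st fy subr0; exact.
have [p1 q1] := bd t (gtr0_norm t0).
have [p2 q2] := bd (- t) (etrans (normrN t) (gtr0_norm t0)).
rewrite -(ler_pM2r t0) -{1}(gtr0_norm t0) -normrM.
move: q1 q2; rewrite !ler_norml mulNr (mulrC l); lra.
Qed.

End Gluing.

(** * Charts of a manifold with boundary *)

Section Charts.
Context {R : realType} {n : nat} {M : bmanifold R n}.
Implicit Types (c d : idx M) (U V W : set M) (p : M) (y : 'rV[R]_n.+1) (i j k l : 'I_n.+1).

Definition cimage c W : set 'rV[R]_n.+1 :=
  cmap (chart c) @` (cdom (chart c) `&` W).

Lemma cimage_inv c W y : cimage c W y ->
  [/\ dom c (cinv (chart c) y), W (cinv (chart c) y) & cmap (chart c) (cinv (chart c) y) = y].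
Proof. by case=> p [dp Wp] <-; rewrite cmapK. Qed.

Lemma cimage_map c W p : dom c p -> W p -> cimage c W (cmap (chart c) p).
Proof. by move=> dp Wp; exists p. Qed.

Lemma cimage_sub c W W' : W `<=` W' -> cimage c W `<=` cimage c W'.
Proof. by move=> sW y [p [dp /sW Wp] <-]; exists p. Qed.

Lemma cimage_half c W y : cimage c W y -> half_space y.
Proof.
case=> p [dp Wp] <-; have [B _ BE] := cmap_image (chart c).
have : (cmap (chart c) @` cdom (chart c)) (cmap (chart c) p) by exists p.
by rewrite BE => -[].
Qed.

Lemma cimage_open c W : open W -> hopen (cimage c W).
Proof.
move=> oW y Wy; split; first exact: cimage_half Wy.
have [dp Wp yE] := cimage_inv Wy; have [B oB BE] := cmap_image (chart c).
have Iy : (cmap (chart c) @` cdom (chart c)) y by exists (cinv (chart c) y).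
have /subspace_continuousP/(_ y Iy) cc := @cinv_continuous _ _ _ (chart c).
have h0 : nbhs (cinv (chart c) y) (cdom (chart c) `&` W).
  apply: open_nbhs_nbhs; split; last by split.
  by apply: openI => //; exact: cdom_open.
have h : within (cmap (chart c) @` cdom (chart c)) (nbhs y)
    [set z | (cdom (chart c) `&` W) (cinv (chart c) z)] := cc _ h0.
have By : B y by have := Iy; rewrite BE => -[].
have hB : nbhs y B by apply: open_nbhs_nbhs.
rewrite /hnbhs /within /=; move: h hB; rewrite /within /=; apply: filterS2 => z hz Bz Hz.
have Iz : (cmap (chart c) @` cdom (chart c)) z by rewrite BE.
have [d1 W1] := hz Iz; exists (cinv (chart c) z) => //.
by case: Iz => q dq <-; rewrite cmapK.
Qed.

(** Being a boundary point is witnessed by a single chart; here every chart has to agree. On the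
    domain of a defining function this takes the place of the topological invariance of the
    boundary. *)
Definition boundary_detected W := forall c p, dom c p -> W p -> mboundary p -> Defs.coord c 0 p = 0.

Lemma differentialE (f : M -> R) c W y : cimage c W y ->
  differential f c (cinv (chart c) y) = hgrad (f \o cinv (chart c)) y.
Proof.
by move=> /cimage_inv[_ _ yE]; apply/rowP => i; rewrite !mxE /pd /dchart yE.
Qed.

(* A defining function has a minimum at a boundary point, so its differential there would
   vanish in a chart that does not see the point on the boundary. *)
Lemma defining_detects U rho : defining_function U rho -> boundary_detected U.
Proof.
move=> [oU srho rho0 rhoE drho] c p dp Up bp.
have Cp := cimage_map dp Up; have := cimage_half Cp; rewrite /half_space /= le_eqVlt.
case/orP => [/eqP e0|pp]; first exact: esym e0.
have := drho c p dp Up bp; case/eqP.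
apply/rowP => i; rewrite !mxE.
apply: (hder_min (@cimage_open c _ oU) (conj Cp pp)).
- by rewrite /pd /dchart; apply: (hs_hder (D := cimage c U)) => //; exact: srho.
- by rewrite /= cmapK//; apply/rhoE.
- by move=> z /cimage_inv[_ Uz _]; exact: rho0.
Qed.

Lemma hint_interior c W y : boundary_detected W -> cimage c W y ->
  0 < y 0 0 <-> minterior (cinv (chart c) y).
Proof.
move=> bW Wy; have [dp Wp yE] := cimage_inv Wy; split=> [y0 bp|ip].
  by have := bW c _ dp Wp bp; rewrite /Defs.coord yE => e0; rewrite e0 ltxx in y0.
have := cimage_half Wy; rewrite /half_space /= le_eqVlt => /orP[/eqP y0|//].
by case: ip; exists c => //; rewrite /Defs.coord yE.
Qed.

Lemma detected_sub W W' : W `<=` W' -> boundary_detected W' -> boundary_detected W.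
Proof. by move=> sW bW c p dp /sW Wp; exact: bW. Qed.

Lemma chart_defining c U rho W : defining_function U rho -> W `<=` U ->
  hdefining (cimage c W) (rho \o cinv (chart c)).
Proof.
move=> rho_def sW; have bU := defining_detects rho_def; have [oU srho rho0 rhoE drho] := rho_def.
have bd y : cimage c W y -> mboundary (cinv (chart c) y) <-> y 0 0 = 0.
  move=> Wy; have [dp Wp yE] := cimage_inv Wy; split=> [bp|y0].
    by have := bU c _ dp (sW _ Wp) bp; rewrite /Defs.coord yE.
  by exists c => //; rewrite /Defs.coord yE.
split.
- by apply: (hs_sub (cimage_sub sW)); exact: srho.
- move=> y Wy; have [dp Wp yE] := cimage_inv Wy; rewrite /= -bd//.
  by apply: rhoE; exact: sW.
- move=> y Wy /(bd _ Wy) bp; have [dp Wp yE] := cimage_inv Wy.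
  by rewrite -(differentialE _ Wy); apply: drho => //; exact: sW.
Qed.

Lemma transition_smooth c d W j :
  hsmooth (cimage c (W `&` dom d)) (fun y => cmap (chart d) (cinv (chart c) y) 0 j).
Proof. by apply: hs_sub (@chart_compatible _ _ M c d j); exact: cimage_sub. Qed.

Lemma open_dom W d : open W -> open (W `&` dom d).
Proof. by move=> oW; apply: openI => //; exact: cdom_open. Qed.

Lemma transition_cont c d W p (f : 'rV[R]_n.+1 -> R) : open W -> dom c p -> dom d p -> W p ->
  hsmooth (cimage d W) f ->
  hcont (fun y => f (cmap (chart d) (cinv (chart c) y))) (cmap (chart c) p).
Proof.
move=> oW dc dd Wp sf; have oD := @cimage_open c _ (@open_dom W d oW).
have Dp : cimage c (W `&` dom d) (cmap (chart c) p) by apply: cimage_map.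
apply: (hcont_comp (phi := fun y => cmap (chart d) (cinv (chart c) y)) (f := f) oD Dp).
- by move=> j; exact: (hs_cont oD (@transition_smooth c d W j) Dp).
- move=> y /cimage_inv[_ [Wy dy] _]; exact: cimage_half (cimage_map dy Wy).
- rewrite cmapK//; apply: (hs_cont (cimage_open oW) sf); exact: cimage_map.
Qed.

Lemma jacE c d W y i j : cimage c W y ->
  jac c d (cinv (chart c) y) i j =
  hpartial i (fun y => cmap (chart d) (cinv (chart c) y) 0 j) y.
Proof. by move=> /cimage_inv[_ _ yE]; rewrite mxE /pd /dchart yE. Qed.

(** In the interior this is [hder_comp], since detection makes chart changes map interior points to
    interior points. At the boundary both sides are limits of their interior values. *)
Lemma chain_rule W f c d p i : open W -> boundary_detected W -> smooth_on W f ->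
  dom c p -> dom d p -> W p -> pd c i f p = \sum_j jac c d p i j * pd d j f p.
Proof.
move=> oW bW sf dc dd Wp; set D := cimage c (W `&` dom d).
have oD : hopen D by apply: cimage_open; exact: open_dom.
have Dp : D (cmap (chart c) p) by apply: cimage_map.
pose phi y := cmap (chart d) (cinv (chart c) y).
have sphi j : hsmooth D (fun y => phi y 0 j) by exact: transition_smooth.
pose F1 y := hpartial i (f \o cinv (chart c)) y.
pose F2 y := \sum_j hpartial i (fun y => phi y 0 j) y * hpartial j (f \o cinv (chart d)) (phi y).
have sfc : hsmooth D (f \o cinv (chart c)).
  by apply: hs_sub (sf c); apply: cimage_sub => q [].
have -> : pd c i f p = F1 (cmap (chart c) p) by [].
have -> : \sum_j jac c d p i j * pd d j f p = F2 (cmap (chart c) p).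
  apply: eq_bigr => j _; rewrite /pd /dchart -/(phi _).
  have := jacE d i j Dp; rewrite cmapK// => ->; rewrite /phi cmapK//.
apply: (hcont_eq (f := F1) (g := F2) oD Dp).
- exact: (hs_cont oD (hs_partial i sfc) Dp).
- apply: hcont_sum => j; apply: hcontM; first exact: (hs_cont oD (hs_partial i (sphi j)) Dp).
  by apply: (transition_cont oW) => //; apply: hs_partial; exact: sf.
move=> y [Dy y0]; have [dy [Wy ddy] yE] := cimage_inv Dy.
have Ey : cimage d W (phi y) by exact: cimage_map.
apply: hderE; first exact: cimage_half Dy.
have iy : minterior (cinv (chart c) y).
  by apply/(hint_interior bW (c := c) (y := y)) => //; apply: cimage_sub Dy => q [].
apply: (hder_congr oD Dy (f := (f \o cinv (chart d)) \o phi)).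
  by move=> z /cimage_inv[_ [_ dz] _]; rewrite /= /phi cmapK.
apply: (hder_comp (D' := cimage d W) oD Dy).
- by move=> j; exact: (hs_hder (i:=i) (sphi j) Dy).
- exact: cimage_open.
- by split => //; apply/(hint_interior bW Ey); rewrite /phi cmapK.
- by move=> z /cimage_inv[_ [Wz dz] _]; exact: cimage_half (cimage_map dz Wz).
- exact: sf.
Qed.

Lemma differential_chain W f c d p : open W -> boundary_detected W -> smooth_on W f ->
  dom c p -> dom d p -> W p ->
  differential f c p = differential f d p *m (jac c d p)^T.
Proof.
move=> oW bW sf dc dd Wp; apply/rowP => i; rewrite !mxE (chain_rule i oW bW sf dc dd Wp).
by apply: eq_bigr => j _; rewrite !mxE mulrC.
Qed.

Lemma shrinking_exists U (rho nu : M -> R) : defining_function U rho -> smooth_on U nu ->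
  (forall p, U p -> mboundary p -> nu p != 0) -> exists V, shrinking U nu V.
Proof.
move=> rho_def snu nu0; have [oU _ _ _ _] := rho_def.
exists (U `&` [set p | nu p != 0]); split; first last.
- by move=> p [].
- by move=> p [Up bp]; split => //; exact: nu0.
- by move=> p [].
(* Continuity of [nu] is known in charts only, so the neighbourhood on which it is non-zero is
   pulled back through [cmap]. *)
rewrite openE => p [Up /= nup]; rewrite /interior /=; apply: filterI.
  by apply: open_nbhs_nbhs.
have [c dp] := chart_cover p; have Cp := cimage_map dp Up.
have := hs_cont (cimage_open oU) (snu c) Cp; rewrite /hcont /= cmapK// => nuc.
have := cvgr_neq0 _ nuc nup; rewrite /hnbhs near_withinE => /(_ (hnbhs_filter _)) nearn.
have /subspace_continuousP/(_ p dp) cmc := @cmap_continuous _ _ _ (chart c).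
have h : within (cdom (chart c)) (nbhs p)
  [set q | half_space (cmap (chart c) q) -> nu (cinv (chart c) (cmap (chart c) q)) != 0].
  exact: cmc _ nearn.
have hd : nbhs p (cdom (chart c)) by apply: open_nbhs_nbhs; split => //; exact: cdom_open.
move: h hd; rewrite /within /=; apply: filterS2 => q hq dq.
have := hq dq; rewrite cmapK//; apply.
exact: cimage_half (cimage_map (W := setT) dq I).
Qed.

End Charts.

(** * The extension of [h] on the manifold *)

Section BoundaryTensor.
Context {R : realType} {n : nat} {M : bmanifold R n}.
Implicit Types (c d : idx M) (W : set M) (p : M) (y : 'rV[R]_n.+1) (i j k l : 'I_n.+1).
Variables (g : tensor2 M) (nabla : symbols M).
Hypothesis g_metric : pseudo_riemannian_metric g.
Hypothesis nabla_lc : levi_civita g nabla.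
Hypothesis g_compact : projectively_compact nabla.
Variables (U : set M) (rho : M -> R).
Hypothesis rho_def : defining_function U rho.
Variable X : vfield M.
Hypothesis X_field : vector_field U X.
Hypothesis XE : agree_on (U `&` @minterior R n M) X
  (fun c p => rho p ^- 3 *: gradient g rho c p).
Hypothesis X0 : forall c p, dom c p -> U p -> mboundary p -> X c p = 0.
Variable nu : M -> R.
Hypothesis nu_smooth : smooth_on U nu.
Hypothesis nuE : forall c p, dom c p -> U p -> minterior p ->
  nu p = rho p ^- 4 * gradient_norm2 g rho c p.
Variable V : set M.
Hypothesis V_shrinks : shrinking U nu V.

Let oV : open V. Proof. by case: V_shrinks. Qed.
Let VU : V `<=` U. Proof. by case: V_shrinks. Qed.
Let nuV p : V p -> nu p != 0. Proof. by case: V_shrinks => _ _ _; apply. Qed.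
Let bU : boundary_detected U. Proof. exact: defining_detects rho_def. Qed.
Let bV : boundary_detected V. Proof. exact: detected_sub VU bU. Qed.
Let srho : smooth_on U rho. Proof. by case: rho_def. Qed.

Let htens c y := h_tensor g rho nu c (cinv (chart c) y).

Let interior_sub c W : W `<=` U -> hint (cimage c W) `<=` cimage c (@minterior R n M).
Proof.
move=> WU y [Wy y0]; have [dp Wp <-] := cimage_inv Wy; apply: cimage_map => //.
by apply/(hint_interior (detected_sub WU bU) Wy).
Qed.

Let htensE c W y : cimage c W y -> htens c y =
  rho (cinv (chart c) y) ^+ 2 *: g c (cinv (chart c) y) -
  ((nu (cinv (chart c) y))^-1 / rho (cinv (chart c) y) ^+ 2) *:
  ((hgrad (rho \o cinv (chart c)) y)^T *m hgrad (rho \o cinv (chart c)) y).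
Proof. by move=> Wy; rewrite /htens /h_tensor (differentialE _ Wy). Qed.

Let smooth_g c W : W `<=` U -> mxsmooth (hint (cimage c W)) (fun y => g c (cinv (chart c) y)).
Proof.
move=> WU i j; have [[sg _] _ _] := g_metric.
exact: (hs_sub (interior_sub WU) (sg c i j)).
Qed.

Lemma h_tensor_interior c : mxsmooth (hint (cimage c V)) (htens c).
Proof.
have oI := hopen_int (@cimage_open _ _ _ c _ oV).
have sub : hint (cimage c V) `<=` cimage c U by move=> y [Vy _]; exact: cimage_sub Vy.
have sr : hsmooth (hint (cimage c V)) (rho \o cinv (chart c)) by exact: hs_sub (srho c).
have sn : hsmooth (hint (cimage c V)) (nu \o cinv (chart c)) by exact: hs_sub (nu_smooth c).
have rho0 y : hint (cimage c V) y -> rho (cinv (chart c) y) != 0.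
  move=> [Vy y0]; have [_ h _] := chart_defining c rho_def VU.
  by apply/eqP => /(h y Vy).1 e0; rewrite /= e0 ltxx in y0.
apply: (mxs_congr oI) => [y [Vy _]|]; first by rewrite (htensE Vy).
apply: mxsD => //; first by apply: mxsZ; [exact: oI|exact: hsX|exact: smooth_g].
apply: mxsN => //; apply: mxsZ => //.
  apply: hsM => //; apply: hsV => //; last exact: hsX.
    by move=> y [/cimage_inv[_ Vp _] _]; exact: nuV.
  by move=> y Iy; rewrite expf_neq0// rho0.
have sg : mxsmooth (hint (cimage c V)) (hgrad (rho \o cinv (chart c))) by exact: mxs_hgrad.
by apply: mxsM => //; exact: mxs_tr.
Qed.

Lemma h_tensor_boundary c p : dom c p -> V p -> mboundary p ->
  exists D' (h : 'rV[R]_n.+1 -> 'M[R]_n.+1),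
    [/\ hopen D', D' (cmap (chart c) p), D' `<=` cimage c V, mxsmooth D' h &
    (forall y, hint D' y -> h y = htens c y) /\
    (forall v : 'rV[R]_n.+1, v 0 0 = 0 ->
       (forall w : 'rV[R]_n.+1, w 0 0 = 0 ->
          (v *m h (cmap (chart c) p) *m w^T) 0 0 = 0) -> v = 0)].
Proof.
move=> dp Vp bp; have [alpha a0 /(_ p bp)[U1 [rho1 [U1p rho1_def [Gbar Gaff GbarE]]]]] := g_compact.
have oU1 : open U1 by case: rho1_def.
set W := V `&` U1; have oW : open W by exact: openI.
have WV : W `<=` V by move=> q [].
have WU : W `<=` U by move=> q /WV /VU.
have WU1 : W `<=` U1 by move=> q [].
set D := cimage c W; have oD : hopen D by exact: cimage_open.
set x := cmap (chart c) p; have Dx : D x by apply: cimage_map.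
have x0 : x 0 0 = 0 by exact: (bV dp Vp bp).
pose inv := cinv (chart c).
have DI y : hint D y -> [/\ dom c (inv y), W (inv y), cmap (chart c) (inv y) = y & minterior (inv y)].
  move=> Iy; have [dq Wq yE] := cimage_inv Iy.1; split => //.
  by apply/(hint_interior (detected_sub WU bU) Iy.1); case: Iy.
have [_ gsym gunit] := g_metric; have [nab_aff lc] := nabla_lc.
(* The row is the upper index and the column the second lower one, so [Gam k] is the endomorphism of
   the derivative in direction [k], and metric compatibility reads [Gam^T g + g Gam]. *)
pose Gam k y : 'M[R]_n.+1 := \matrix_(l, i) nabla c (inv y) l k i.
pose Gam1 k y : 'M[R]_n.+1 := \matrix_(l, i) Gbar c (inv y) l k i.
have sg : mxsmooth (hint D) (fun y => g c (inv y)) by exact: smooth_g.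
have gs y : hint D y -> (g c (inv y))^T = g c (inv y).
  by case/DI => dq _ _ iq; exact: gsym.
have gu y : hint D y -> g c (inv y) \in unitmx by case/DI => dq _ _ iq; exact: gunit.
have dg k y : hint D y -> mxder k (fun y => g c (inv y)) y
    ((Gam k y)^T *m g c (inv y) + g c (inv y) *m Gam k y).
  move=> Iy a b; have [dq Wq yE iq] := DI y Iy.
  apply: hder_eq (hs_hder (i:=k) (sg a b) Iy) _.
  have := lc c (inv y) dq iq k a b; rewrite /pd /dchart yE => -> .
  by rewrite !mxE -big_split /=; apply: eq_bigr => l _; rewrite !mxE [nabla _ _ _ k b * _]mulrC.
have rdef : hdefining D (rho \o inv) by exact: chart_defining rho_def WU.
have r1def : hdefining D (rho1 \o inv) by exact: chart_defining rho1_def WU1.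
have snu : hsmooth D (nu \o inv).
  by apply: hs_sub (nu_smooth c); exact: cimage_sub.
have nu0 y : D y -> (nu \o inv) y != 0 by case/cimage_inv => _ /WV Vq _; exact: nuV.
have sX : mxsmooth D (fun y => X c (inv y)).
  move=> a b; rewrite (ord1 a); case: X_field => sX _.
  by apply: hs_sub (sX c b); exact: cimage_sub.
have X0' y : D y -> y 0 0 = 0 -> X c (inv y) = 0.
  move=> /cimage_inv[dq Wq yE] y0; apply: X0 => //; first exact: WU.
  by exists c => //; rewrite /Defs.coord yE.
have XE' y : hint D y -> X c (inv y) =
    (rho \o inv) y ^- 3 *: (hgrad (rho \o inv) y *m invmx (g c (inv y))).
  move=> Iy; have [dq Wq yE iq] := DI y Iy.
  by rewrite XE//; [rewrite /gradient (differentialE _ Iy.1)|split => //; exact: WU].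
have nuE' y : hint D y -> (nu \o inv) y = (rho \o inv) y ^- 4 *
    (hgrad (rho \o inv) y *m invmx (g c (inv y)) *m (hgrad (rho \o inv) y)^T) 0 0.
  move=> Iy; have [dq Wq yE iq] := DI y Iy.
  by rewrite /= (nuE dq (WU _ Wq) iq) /gradient_norm2 (differentialE _ Iy.1).
have sG1 k : mxsmooth D (Gam1 k).
  move=> a b; case: Gaff => sG _ _.
  apply: (hs_congr oD (f := (fun q => Gbar c q a k b) \o inv)) => [y _|]; first by rewrite mxE.
  by apply: hs_sub (sG c a k b); exact: cimage_sub.
have G1E k y : hint D y -> Gam1 k y = Gam k y +
    projterm (delta_mx k 0) ((alpha * (rho1 \o inv) y)^-1 *: hgrad (rho1 \o inv) y).
  move=> Iy; have [dq Wq yE iq] := DI y Iy; apply/matrixP => a b.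
  rewrite [LHS]mxE (GbarE c (inv y) dq (conj (WU1 _ Wq) iq)) /projective_change.
  by rewrite (differentialE _ Iy.1) [LHS]mxE [RHS]mxE projtermE [Gam k y a b]mxE addrA.
have [D' [h [oD' D'x D'D sh [hE hn]]]] := core_extension oD Dx x0 sg gs gu dg rdef snu nu0 sX
  X0' XE' nuE' (lt0r_neq0 a0) r1def sG1 G1E.
exists D', h; split => //.
  by move=> y /D'D; exact: cimage_sub.
split => // y Iy; rewrite hE// (htensE (W := W))//; exact: D'D Iy.1.
Qed.

Lemma h_tensor_extends_in_chart c : exists2 G : 'rV[R]_n.+1 -> 'M[R]_n.+1,
  mxsmooth (cimage c V) G & forall y, hint (cimage c V) y -> G y = htens c y.
Proof.
have oD := @cimage_open _ _ _ c _ oV.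
apply: (@mxsmooth_glue _ _ (cimage c V) _ _ (htens c) oD).
move=> x Vx; have [dp Vp xE] := cimage_inv Vx.
have [bp|ip] := pselect (mboundary (cinv (chart c) x)).
  have [D' [h [oD' D'x D'V sh [hE _]]]] := h_tensor_boundary dp Vp bp.
  by exists D', h; split => //; rewrite -xE.
exists (hint (cimage c V)), (htens c); split => //.
- by apply: hopen_int; exact: cimage_open.
- by split => //; apply/(hint_interior bV Vx).
- by move=> y [].
- exact: h_tensor_interior.
Qed.

Lemma h_tensor_extends : exists hbar : tensor2 M,
  [/\ covariant2_field V hbar, agree_on (V `&` @minterior R n M) hbar (h_tensor g rho nu) &
      nondegenerate_on_boundary V hbar].
Proof.
have /choice[G GP] : forall c, exists G : 'rV[R]_n.+1 -> 'M[R]_n.+1,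
    mxsmooth (cimage c V) G /\ forall y, hint (cimage c V) y -> G y = htens c y.
  by move=> c; have [G sG GE] := h_tensor_extends_in_chart c; exists G.
pose hbar : tensor2 M := fun c p => G c (cmap (chart c) p).
have hI c p : dom c p -> V p -> minterior p -> hbar c p = h_tensor g rho nu c p.
  move=> dp Vp ip; have Vx := cimage_map dp Vp; rewrite /hbar (GP c).2 /htens ?cmapK//.
  by split => //; apply/(hint_interior bV Vx); rewrite cmapK.
exists hbar; split; last 2 first.
- by move=> c p dp [Vp ip]; exact: hI.
- move=> c p dp Vp bp v v0 hv.
  have [D' [h [oD' D'x D'V sh [hE hn]]]] := h_tensor_boundary dp Vp bp.
  (* [G c] results from a choice of local extensions, whereas non-degeneracy is known for [h];
     continuity identifies the two at the boundary point. *)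
  have GhE : G c (cmap (chart c) p) = h (cmap (chart c) p).
    apply: (mx_hcont_eq (A := G c) (B := h) oD' D'x) => //.
      by move=> a b; exact: (hs_sub D'V ((GP c).1 a b)).
    by move=> y Iy; rewrite hE// (GP c).2//; split; [exact: D'V Iy.1|case: Iy].
  by apply: hn => // w w0; rewrite -GhE; exact: hv.
split=> [c i j|c d p dc dd Vp].
  apply: (hs_congr (cimage_open oV) (f := fun y => G c y i j)); last exact: (GP c).1.
  by move=> y /cimage_inv[_ _ yE]; rewrite /hbar /= yE.
(* The transformation law holds in the interior by those of [g] and [d rho]. Both sides are
   continuous in the chart [c], so it persists at the boundary. *)
set D := cimage c (V `&` dom d); have oD : hopen D by apply: cimage_open; exact: open_dom.
have Dp : D (cmap (chart c) p) by apply: cimage_map.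
pose phi y := cmap (chart d) (cinv (chart c) y).
pose J y : 'M[R]_n.+1 := jac c d (cinv (chart c) y).
have sJ : mxsmooth D J.
  move=> a b; apply: (hs_congr oD (f := hpartial a (fun y => phi y 0 b))) => [y Dy|].
    by rewrite /J (jacE _ _ _ Dy).
  by apply: hs_partial; exact: transition_smooth.
apply/matrixP => a b.
have := @hcont_eq _ _ D (fun y => G c y a b)
  (fun y => \sum_k (\sum_l J y a l * G d (phi y) l k) * J y b k) _ oD Dp.
rewrite /J /phi !cmapK// => ->.
- rewrite !mxE; apply: eq_bigr => k _; rewrite !mxE.
  by congr (_ * _).
- apply: (hs_cont oD _ Dp); apply: hs_sub ((GP c).1 a b).
  by apply: cimage_sub => q [].
- apply: hcont_sum => k; apply: hcontM; last exact: (hs_cont oD (sJ b k) Dp).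
  apply: hcont_sum => l; apply: hcontM; first exact: (hs_cont oD (sJ a l) Dp).
  by apply: (@transition_cont _ _ _ c d V p (fun z => G d z l k) oV) => //; exact: (GP d).1.
move=> y [Dy y0]; have [dq [Vq ddq] yE] := cimage_inv Dy; set q := cinv (chart c) y in dq Vq ddq yE *.
have Vy : cimage c V y by apply: cimage_sub Dy => z [].
have iq : minterior q by apply/(hint_interior bV Vy).
have -> : G c y = h_tensor g rho nu c q by rewrite -(hI c q)// /hbar yE.
have -> : G d (cmap (chart d) q) = h_tensor g rho nu d q by rewrite -(hI d q).
have oU : open U by case: rho_def.
have := congr1 (fun A : 'M[R]_n.+1 => A a b) (_ : h_tensor g rho nu c q =
  jac c d q *m h_tensor g rho nu d q *m (jac c d q)^T).
rewrite !mxE => ->.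
  by apply: eq_bigr => k _; rewrite !mxE; congr (_ * _).
have [[_ gcov] _ _] := g_metric.
rewrite /h_tensor (gcov c d q dq ddq iq) (differential_chain oU bU srho dq ddq (VU Vq)).
rewrite trmx_mul trmxK mulmxBr mulmxBl -!scalemxAr -!scalemxAl; congr (_ - _ *: _).
by rewrite !mulmxA.
Qed.

End BoundaryTensor.

(** * The derivative of [nu^-1] along fields annihilated by [d rho] *)

Lemma boundary_directional (R : realType) (n : nat) (M : bmanifold R n)
  (V : set M) (rho nu nu2 : M -> R) (nu0 : R) (zeta : vfield M) :
  open V -> boundary_detected V -> smooth_on V rho -> smooth_on V nu -> smooth_on V nu2 ->
  (forall p, V p -> nu p != 0) ->
  (forall p, V p -> minterior p -> rho p != 0) ->
  (forall p, V p -> nu p = nu0 + rho p ^+ 2 * nu2 p) ->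
  vector_field V zeta ->
  (forall c p, dom c p -> V p -> directional zeta rho c p = 0) ->
  exists2 f : M -> R, smooth_on V f &
    forall c p, dom c p -> V p -> minterior p ->
      f p = rho p ^- 2 * directional zeta (fun q => (nu q)^-1) c p.
Proof.
move=> oV bV srho snu snu2 nuV rhoI nu_form [szeta zeta_tr] zrho.
have /choice[ch chP] := @chart_cover _ _ M.
(* A function on the manifold needs one value per point, so a chart is chosen at each point; [dirE]
   shows that the value does not depend on it. *)
pose f p := - ((nu p)^-1 * (nu p)^-1) * directional zeta nu2 (ch p) p.
have dirE c d p : dom c p -> dom d p -> V p -> directional zeta nu2 c p = directional zeta nu2 d p.
  move=> dc dd Vp; rewrite /directional (zeta_tr c d p dc dd Vp).
  under eq_bigr => i _ do rewrite (chain_rule i oV bV snu2 dc dd Vp) mulr_sumr.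
  rewrite exchange_big /=; apply: eq_bigr => j _; rewrite mxE mulr_suml.
  by apply: eq_bigr => i _; rewrite mulrA.
have fE c p : dom c p -> V p -> f p = - ((nu p)^-1 * (nu p)^-1) * directional zeta nu2 c p.
  by move=> dc Vp; rewrite /f (dirE (ch p) c p (chP p) dc Vp).
have hds c F y i : smooth_on V F -> cimage c V y ->
    hder i (F \o cinv (chart c)) y (pd c i F (cinv (chart c) y)).
  move=> sF Vy; have [_ _ yE] := cimage_inv Vy.
  by rewrite /pd /dchart yE; exact: (hs_hder (i:=i) (sF c) Vy).
exists f => [c|c p dp Vp ip].
  have oD := @cimage_open _ _ _ c _ oV.
  apply: (hs_congr oD (f := fun y => - (((nu \o cinv (chart c)) y)^-1 * ((nu \o cinv (chart c)) y)^-1) *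
     \sum_i zeta c (cinv (chart c) y) 0 i * hpartial i (nu2 \o cinv (chart c)) y)).
    move=> y /cimage_inv[dq Vq yE]; rewrite /= (fE c)//; congr (_ * _).
    by apply: eq_bigr => i _; rewrite /pd /dchart yE.
  have sV : hsmooth (cimage c V) (fun y => ((nu \o cinv (chart c)) y)^-1).
    apply: hsV => //; last exact: snu.
    by move=> y /cimage_inv[_ Vq _]; exact: nuV.
  apply: hsM => //; first by apply: hsN => //; exact: hsM.
  by apply: hs_sum => // i; apply: hsM => //; [exact: szeta|apply: hs_partial; exact: snu2].
have r0 := rhoI p Vp ip; have n0 := nuV p Vp.
have Vx := cimage_map dp Vp; have oD := @cimage_open _ _ _ c _ oV.
have dnuV i : pd c i (fun q => (nu q)^-1) p =
    - (2 * rho p * pd c i rho p * nu2 p + rho p ^+ 2 * pd c i nu2 p) / nu p ^+ 2.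
  apply: hderE; first exact: cimage_half Vx.
  have h1 := hds c rho _ i srho Vx; have h2 := hds c nu2 _ i snu2 Vx; rewrite cmapK// in h1 h2.
  have h3 := hderD (hder_cst i nu0 _) (hderM (hderM h1 h1) h2); rewrite /= cmapK// in h3.
  have h4 : hder i (nu \o cinv (chart c)) (cmap (chart c) p)
      (2 * rho p * pd c i rho p * nu2 p + rho p ^+ 2 * pd c i nu2 p).
    apply: hder_eq (hder_congr oD Vx _ h3) _; last by ring.
    by move=> y /cimage_inv[_ Vq _]; rewrite /= nu_form// expr2.
  have := hderV _ h4; rewrite /= cmapK//; exact.
rewrite (fE c)// /directional.
(* The first part is a multiple of the derivative of [rho] along [zeta], hence zero; the second has
   the factor [rho^2] that cancels [rho^-2]. *)
have -> : \sum_i zeta c p 0 i * pd c i (fun q => (nu q)^-1) p =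
  - (2 * rho p * nu2 p / nu p ^+ 2) * directional zeta rho c p +
  - (rho p ^+ 2 / nu p ^+ 2) * \sum_i zeta c p 0 i * pd c i nu2 p.
  rewrite /directional !mulr_sumr -big_split /=; apply: eq_bigr => i _; rewrite dnuV.
  by field.
rewrite zrho// mulr0 add0r; set s := \sum_i _.
by field; rewrite r0 n0.
Qed.

Theorem proposition3p14 (R : realType) (n : nat) (Mbar : bmanifold R n)
  (g : tensor2 Mbar) (nabla : symbols Mbar)
  (g_metric : pseudo_riemannian_metric g)
  (nabla_lc : levi_civita g nabla)
  (g_compact : projectively_compact nabla)
  (g_ricci_flat : ricci_flat nabla)
  (U : set Mbar) (rho : Mbar -> R)
  (rho_def : defining_function U rho)
  (grad_bdry : exists X : vfield Mbar,
     [/\ vector_field U X,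
         agree_on (U `&` @minterior R n Mbar) X
           (fun c p => rho p ^- 3 *: gradient g rho c p) &
         forall c p, dom c p -> U p -> mboundary p -> X c p = 0])
  (nu nu2 : Mbar -> R) (nu0 : R)
  (nu_smooth : smooth_on U nu)
  (nuE : forall c p, dom c p -> U p -> minterior p ->
     nu p = rho p ^- 4 * gradient_norm2 g rho c p)
  (nu0_neq0 : nu0 != 0)
  (nu2_smooth : smooth_on U nu2)
  (nu_form : forall p, U p -> nu p = nu0 + rho p ^+ 2 * nu2 p) :
  (exists V : set Mbar, shrinking U nu V) /\
  (forall V : set Mbar, shrinking U nu V ->
     (exists hbar : tensor2 Mbar,
        [/\ covariant2_field V hbar,
            agree_on (V `&` @minterior R n Mbar) hbar (h_tensor g rho nu) &
            nondegenerate_on_boundary V hbar]) /\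
     (forall zeta : vfield Mbar, vector_field V zeta ->
        (forall c p, dom c p -> V p -> directional zeta rho c p = 0) ->
        exists2 f : Mbar -> R, smooth_on V f &
          forall c p, dom c p -> V p -> minterior p ->
            f p = rho p ^- 2 *
                  directional zeta (fun q => (nu q)^-1) c p)).
Proof.
have [oU srho rho0 rhoE drho] := rho_def; split.
  apply: (shrinking_exists rho_def nu_smooth) => p Up bp.
  by rewrite nu_form// (rhoE p Up).2// expr0n mul0r addr0.
move=> V V_shrinks; have [oV VU _ nuV] := V_shrinks; split.
  have [X [X_field XE X0]] := grad_bdry.
  exact: (h_tensor_extends g_metric nabla_lc g_compact rho_def X_field XE X0 nu_smooth nuE).
have sub F : smooth_on U F -> smooth_on V F.
  by move=> sF c; apply: hs_sub (sF c); exact: cimage_sub.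
move=> zeta; apply: (boundary_directional (nu2 := nu2) (nu0 := nu0)) => //.
- exact: detected_sub VU (defining_detects rho_def).
- exact: sub.
- exact: sub.
- exact: sub.
- by move=> p /VU Up ip; apply/eqP => /(rhoE p Up).
- by move=> p /VU; exact: nu_form.
Qed.
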